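(* Let $d\ge 1$ and $\sigma>0$ satisfy $1<\sigma d<2$, let $p^*:=\frac{\sigma d}{\sigma d-1}$, and let $p^*<p\le\infty$. Then the nonlinear Schr\''odinger equation $$ i\psi_t(t,\mathbf{x})+\Delta\psi+|\psi|^{2\sigma}\psi=0,\qquad \mathbf{x}\in\mathbb{R}^d,$$ admits classical (smooth) solutions $\psi$ that become singular at a finite time $T_c$ in $L^p$, i.e., $\|\psi(t)\|_p<\infty$ for $0\le t<T_c$ and $\lim_{t\to T_c}\|\psi(t)\|_p=\infty$.
   Context: $\Delta=\sum_{j=1}^d\partial_{x_jx_j}$ is the Laplacian on $\mathbb{R}^d$, and $\|\cdot\|_p$ denotes the $L^p(\mathbb{R}^d)$ norm in the spatial variable $\mathbf{x}$. *)

(* Defs.v *)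
From HB Require Import structures.
From mathcomp Require Import all_boot all_order all_algebra.
From mathcomp Require Import all_classical all_reals all_analysis.
Set Implicit Arguments. Unset Strict Implicit. Unset Printing Implicit Defensive.
Import Order.TTheory GRing.Theory Num.Theory.
Import numFieldNormedType.Exports.
Local Open Scope classical_set_scope.
Local Open Scope ring_scope.

(* ---- complex numbers represented as pairs (Re, Im) in R * R ---- *)
Definition mulI {R : realType} (w : R * R) : R * R := (- w.2, w.1).
Definition cabs {R : realType} (w : R * R) : R := Num.sqrt (w.1 ^+ 2 + w.2 ^+ 2).

Fixpoint iterD {R : realType} {V W : normedModType R}
   (vs : seq V) (f : V -> W) : V -> W :=
  match vs with
  | [::] => f
  | v :: vs' => fun z => 'D_v (iterD vs' f) z
  end.

Definition smooth_on {R : realType} {V W : normedModType R}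
   (U : set V) (f : V -> W) : Prop :=
  forall (vs : seq V) (z : V), U z -> differentiable (iterD vs f) z.

Definition e_time {R : realType} (d : nat) : R * 'rV[R]_d := (1, 0).
Definition e_space {R : realType} (d : nat) (j : 'I_d) : R * 'rV[R]_d :=
  (0, delta_mx 0 j).

Definition laplacian {R : realType} {d : nat} {W : normedModType R}
   (f : R * 'rV[R]_d -> W) (z : R * 'rV[R]_d) : W :=
  \sum_(j < d) 'D_(e_space j) ('D_(e_space j) f) z.

(* ---- Lebesgue integral on R^d of a nonnegative function, as the iterated
   one-dimensional Lebesgue integral (Tonelli) ---- *)
Definition rcons_row {R : realType} (n : nat) (x : R) (y : 'rV[R]_n)
  : 'rV[R]_n.+1 :=
  \row_(i < n.+1) (if unlift ord0 i is Some j then y 0 j else x).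

Fixpoint iint {R : realType} (n : nat) : ('rV[R]_n -> \bar R) -> \bar R :=
  match n with
  | 0 => fun F => F 0
  | n'.+1 => fun F =>
      (\int[@lebesgue_measure R]_x iint (fun y => F (rcons_row x y)))%E
  end.

Definition null_set {R : realType} (n : nat) (A : set 'rV[R]_n) : Prop :=
  iint (fun x => (\1_A x)%:E) = 0%E.

(* L^p norm on R^d, 0 < p <= +oo (same shape as mathcomp's Lnorm) *)
Definition Lpnorm {R : realType} (n : nat) (p : \bar R) (f : 'rV[R]_n -> R)
  : \bar R :=
  match p with
  | p%:E => ((iint (fun x => (`|f x| `^ p)%:E)) `^ p^-1)%E
  | +oo%E => ereal_inf [set M : \bar R |
                 null_set [set x | M < (`|f x|)%:E]%E]
  | -oo%E => 0%E
  end.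

(* Main.v *)
Require Import Defs.
From HB Require Import structures.
From mathcomp Require Import all_boot all_order all_algebra.
From mathcomp Require Import all_classical all_reals all_analysis.
From mathcomp Require Import measurable_realfun ring lra.
Import Order.TTheory GRing.Theory Num.Theory.
Import numFieldNormedType.Exports.
Local Open Scope classical_set_scope.
Local Open Scope ring_scope.
Set Implicit Arguments.
Unset Strict Implicit.
Unset Printing Implicit Defensive.

(* Look for a self-similar solution
     psi(t, x) = (1 - t)^(-1/(2 sigma)) S(|x|^2 / (1 - t)),  S(y) = exp(-i y/8) F(y).
   The equation becomes the radial profile equation
     4 y F'' + 2 d F' + (y/16 + i beta + |F|^(2 sigma)) F = 0,
     beta = 1/(2 sigma) - d/4 > 0,
   i.e. F'(y) = -1/2 int_0^1 u^(d-1) H(u^2 y) du with H = (y/16 + i beta + |F|^(2 sigma)) F.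
   This integral equation is solved on the whole line by Picard iteration in a
   weighted norm, after truncating the nonlinearity at a large modulus; the regular
   form at y = 0 also yields smoothness by bootstrapping, provided F has no zero
   (sigma need not be an integer).  In the variable r with y = r^2:
   - no zeros: (r^d Im(conj(F) F'))' = -(beta/2) r^(d-1) |F|^2 < 0;
   - a Gronwall argument for the energy 4 r^2 |F'|^2 + r^2/16 |F|^2 + G(|F|^2)
     corrected by the virial term 2 d Re(conj(F) F') gives the sharp decay
     |F|^2 <= B (1 + r^2)^(-(d - 1/sigma)) with B independent of the truncation,
     which is therefore inactive.
   The decay puts S in L^p for p > p*, and since |S| is bounded below near
   the origin, ||psi(t)||_p >= c (1 - t)^(-(1/(2 sigma) - d/(2p))), which blows up
   because p > p* > sigma d. *)

(** * Derivatives and primitives on the line *)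

Section scalar_derivatives.
Context {R : realType}.
Implicit Types (f g : R -> R) (x d e : R).

Lemma D1_cst c x : is_derive x (1 : R) (fun=> c : R) 0.
Proof. exact: is_derive_cst. Qed.

Lemma D1_id x : is_derive x (1 : R) (fun y : R => y) 1.
Proof. exact: is_derive_id. Qed.

Lemma D1_add f g x d e : is_derive x (1 : R) f d -> is_derive x (1 : R) g e ->
  is_derive x (1 : R) (fun y => f y + g y) (d + e).
Proof. by move=> df dg; exact: is_deriveD. Qed.

Lemma D1_sub f g x d e : is_derive x (1 : R) f d -> is_derive x (1 : R) g e ->
  is_derive x (1 : R) (fun y => f y - g y) (d - e).
Proof. by move=> df dg; exact: is_deriveB. Qed.

Lemma D1_opp f x d : is_derive x (1 : R) f d ->
  is_derive x (1 : R) (fun y => - f y) (- d).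
Proof. by move=> df; exact: is_deriveN. Qed.

Lemma D1_mul f g x d e : is_derive x (1 : R) f d -> is_derive x (1 : R) g e ->
  is_derive x (1 : R) (fun y => f y * g y) (f x * e + g x * d).
Proof. by move=> df dg; exact: is_deriveM. Qed.

Lemma D1_comp f g x d e : is_derive (g x) (1 : R) f d ->
  is_derive x (1 : R) g e -> is_derive x (1 : R) (fun y => f (g y)) (d * e).
Proof. by move=> df dg; exact: (@is_derive1_comp _ f g). Qed.

Lemma D1_exp f n x d : is_derive x (1 : R) f d ->
  is_derive x (1 : R) (fun y => f y ^+ n) (n%:R * f x ^+ n.-1 * d).
Proof.
move=> df; have h := @is_deriveX R R^o f n x 1 d df.
by rewrite (_ : (fun y => _) = (f ^+ n)%R) //; apply/funext => y; rewrite exprfctE.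
Qed.

Lemma D1_eq f x d e : is_derive x (1 : R) f d -> d = e ->
  is_derive x (1 : R) f e.
Proof. by move=> + <-. Qed.

Lemma D1_continuous f x d : is_derive x (1 : R) f d -> {for x, continuous f}.
Proof.
by move=> [df _]; apply: differentiable_continuous; exact/derivable1_diffP.
Qed.

Lemma D1_expR f x d : is_derive x (1 : R) f d ->
  is_derive x (1 : R) (fun y => expR (f y)) (expR (f x) * d).
Proof. by move=> df; apply: D1_comp => //; exact: is_derive_expR. Qed.

End scalar_derivatives.

Ltac Dstep := first [eassumption | lazymatch goal with
  | |- is_derive _ _ (fun y => @GRing.exp _ (@?f y) _) _ => eapply D1_exp
  | |- is_derive _ _ (fun y => @GRing.mul _ (@?f y) (@?g y)) _ => eapply D1_mul
  | |- is_derive _ _ (fun y => @GRing.add _ (@?f y) (- (@?g y))) _ => eapply D1_sub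
  | |- is_derive _ _ (fun y => @GRing.add _ (@?f y) (@?g y)) _ => eapply D1_add
  | |- is_derive _ _ (fun y => @GRing.opp _ (@?f y)) _ => eapply D1_opp
  | |- is_derive _ _ (fun y => @expR _ (@?f y)) _ => eapply D1_expR
  | |- is_derive _ _ (@GRing.mul _ ?c) _ =>
      eapply (@D1_mul _ (fun=> c) (fun y => y))
  | |- is_derive _ _ (@GRing.add _ ?c) _ =>
      eapply (@D1_add _ (fun=> c) (fun y => y))
  | |- is_derive _ _ (@GRing.opp _) _ => eapply (@D1_opp _ (fun y => y))
  | |- is_derive _ _ (fun y => y) _ => eapply D1_id
  | |- is_derive _ _ (fun y => ?c) _ => eapply D1_cst
  | |- _ => fail end].
Ltac Dsolve := eapply D1_eq; [solve [repeat Dstep]|rewrite /=].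
Section mean_value.
Context {R : realType}.
Implicit Types (f g h : R -> R).

Lemma le_of_derive_le0 f df (a b : R) : a <= b ->
  (forall x, a <= x <= b -> {for x, continuous f}) ->
  (forall x, a < x < b -> is_derive x (1 : R) f (df x)) ->
  (forall x, a < x < b -> df x <= 0) -> f b <= f a.
Proof.
move=> ab cf df_ df0.
apply: (@ler0_derive1_le_cc R f a b); rewrite ?in_itv/= ?lexx ?ab//.
- by move=> x; rewrite in_itv/= => /df_[].
- by move=> x; rewrite in_itv/= => /[dup] /df_ ? /df0; rewrite derive1E derive_val.
- by apply: continuous_in_subspaceT => x; rewrite inE/= in_itv/=; exact: cf.
Qed.

Lemma eq_of_derive_eq f g df (a b : R) : a <= b ->
  (forall x, a <= x <= b -> {for x, continuous f}) ->
  (forall x, a <= x <= b -> {for x, continuous g}) ->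
  (forall x, a < x < b -> is_derive x (1 : R) f (df x)) ->
  (forall x, a < x < b -> is_derive x (1 : R) g (df x)) ->
  f b - f a = g b - g a.
Proof.
move=> ab cf cg df_ dg.
have key (f1 f2 : R -> R) :
    (forall x, a <= x <= b -> {for x, continuous f1}) ->
    (forall x, a <= x <= b -> {for x, continuous f2}) ->
    (forall x, a < x < b -> is_derive x (1 : R) f1 (df x)) ->
    (forall x, a < x < b -> is_derive x (1 : R) f2 (df x)) ->
    f1 b - f2 b <= f1 a - f2 a.
  move=> c1 c2 d1 d2.
  apply: (@le_of_derive_le0 (fun x => f1 x - f2 x) (fun x => df x - df x)) => //.
  - by move=> x xab; apply: continuousB; [exact: c1|exact: c2].
  - by move=> x xab; apply: D1_sub; [exact: d1|exact: d2].
  - by move=> x _; rewrite subrr.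
have := key f g cf cg df_ dg; have := key g f cg cf dg df_; lra.
Qed.

End mean_value.

Section primitive.
Context {R : realType}.
Implicit Types (f g h : R -> R).
Notation mu := (@lebesgue_measure R).

Lemma continuous_integrable_itv (a b : R) h :
  (forall x, a <= x <= b -> {for x, continuous h}) ->
  mu.-integrable `[a, b] (EFin \o h).
Proof.
move=> ch; apply: continuous_compact_integrable; first exact: segment_compact.
by apply: continuous_in_subspaceT => x; rewrite inE/= in_itv/=; exact: ch.
Qed.

Lemma exists_primitive h : continuous h ->
  exists f : R -> R, f 0 = 0 /\ forall x, is_derive x (1 : R) f (h x).
Proof.
move=> ch.
pose F M y := \int[mu]_(t in `[- M, y]) h t - \int[mu]_(t in `[- M, 0%R]) h t.
have dF (M y : R) : - M < y -> is_derive y (1 : R) (F M) (h y).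
  move=> My.
  have [] := @continuous_FTC1_closed R h (- M) y (y + 1).
  - by rewrite ltrDl.
  - by apply: continuous_integrable_itv => x _; exact: ch.
  - exact: My.
  - exact: ch.
  move=> dI IE; apply: D1_eq (subr0 _).
  have dI' : is_derive y (1 : R)
      (fun y => \int[mu]_(t in `[- M, y]) h t : R) (h y).
    by split; [exact: dI|rewrite -IE derive1E].
  exact: (D1_sub dI' (D1_cst _ _)).
have F0 M : F M 0 = 0 by rewrite /F subrr.
have FE (M M' y : R) : `|y| < M -> `|y| < M' -> F M y = F M' y.
  wlog MM' : M M' / M <= M'.
    by move=> H; have [/H|/ltW/H] := leP M M'; [|move=> K ? ?; apply/esym/K].
  move=> yM yM'; have [y0|y0] := leP 0 y.
    have := @eq_of_derive_eq R (F M) (F M') h 0 y y0.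
    rewrite !F0 !subr0; apply => x /andP[x0 xy].
    - by have /D1_continuous : is_derive x (1 : R) (F M) (h x) by
        apply: dF; move: yM; rewrite ger0_norm//; lra.
    - by have /D1_continuous : is_derive x (1 : R) (F M') (h x) by
        apply: dF; move: yM; rewrite ger0_norm//; lra.
    - by apply: dF; move: yM; rewrite ger0_norm//; lra.
    - by apply: dF; move: yM; rewrite ger0_norm//; lra.
  have := @eq_of_derive_eq R (F M) (F M') h y 0 (ltW y0).
  rewrite !F0 !sub0r => K; apply: oppr_inj; apply: K => x /andP[x0 xy].
  - by have /D1_continuous : is_derive x (1 : R) (F M) (h x) by
      apply: dF; move: yM; rewrite ltr0_norm//; lra.
  - by have /D1_continuous : is_derive x (1 : R) (F M') (h x) by
      apply: dF; move: yM; rewrite ltr0_norm//; lra.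
  - by apply: dF; move: yM; rewrite ltr0_norm//; lra.
  - by apply: dF; move: yM; rewrite ltr0_norm//; lra.
exists (fun y => F (`|y| + 1) y); split; first by rewrite F0.
move=> x.
apply: (@near_eq_is_derive _ _ _ (F (`|x| + 2))); last first.
  by apply: dF; have := ler_norm (- x); rewrite normrN; lra.
near=> z; apply: FE; last by rewrite ltrDl.
suff : `|z - x| < 1 by have := ler_normD (z - x) x; rewrite subrK; lra.
by rewrite distrC; near: z; apply: nbhsx_ballx.
Unshelve. all: by end_near. Qed.

End primitive.

(** * Radial averages *)

Section radial_average.
Context {R : realType}.
Implicit Types (f g h : R -> R).
Notation mu := (@lebesgue_measure R).

(* [f = avg k h] is the solution of [2 y f' + (k + 1) f = h] that is regular at
   [y = 0]; for [k = d - 1] and [y = r^2] it inverts the radial Laplacian. *)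
Definition avg k h (y : R) : R := \int[mu]_(u in `[0, 1]) (u ^+ k * h (u ^+ 2 * y)).

Lemma bounded_on_itv (p q : R) h : p <= q ->
  (forall x, p <= x <= q -> {for x, continuous h}) ->
  exists2 C, 0 <= C & forall x, p <= x <= q -> `|h x| <= C.
Proof.
move=> pq ch.
have [|c _ hc] := @EVT_max R (fun x => `|h x|) p q pq.
  apply: continuous_in_subspaceT => x; rewrite inE/= in_itv/= => xpq.
  by apply: continuous_comp; [exact: ch|exact: norm_continuous].
by exists `|h c| => // x xpq; apply: hc; rewrite in_itv.
Qed.

Lemma sqr_mul_itv (p q u y : R) : 0 <= u <= 1 -> p <= 0 <= q -> p <= y <= q ->
  p <= u ^+ 2 * y <= q.
Proof.
move=> /andP[u0 u1] /andP[p0 q0] /andP[py yq].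
have u20 : 0 <= u ^+ 2 by rewrite exprn_ge0.
have u21 : u ^+ 2 <= 1 by rewrite exprn_ile1.
apply/andP; split; nra.
Qed.

Lemma avg_integrand_continuous k h (p q y : R) : p <= 0 <= q -> p <= y <= q ->
  (forall x, p <= x <= q -> {for x, continuous h}) ->
  forall u : R, 0 <= u <= 1 -> {for u, continuous (fun u : R => u ^+ k * h (u ^+ 2 * y))}.
Proof.
move=> pq ypq ch u u01; apply: continuousM; first exact: exprn_continuous.
apply: (@continuous_comp _ _ _ (fun u : R => u ^+ 2 * y) h).
  apply: continuousM; first exact: exprn_continuous.
  exact: cst_continuous.
exact/ch/sqr_mul_itv.
Qed.

Lemma avg_integrable k h (p q y : R) : p <= 0 <= q -> p <= y <= q ->
  (forall x, p <= x <= q -> {for x, continuous h}) ->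
  mu.-integrable `[0, 1] (EFin \o (fun u : R => u ^+ k * h (u ^+ 2 * y))).
Proof.
move=> pq ypq ch; apply: continuous_integrable_itv => u u01.
exact: (avg_integrand_continuous pq ypq ch).
Qed.

Lemma integrable01_cst (C : R) : mu.-integrable `[0, 1] (EFin \o (fun=> C)).
Proof. by apply: continuous_integrable_itv => x _; exact: cst_continuous. Qed.

Lemma Rintegral01_cst (C : R) : \int[mu]_(u in `[0%R, 1%R]) C = C.
Proof.
by rewrite Rintegral_cst//= lebesgue_measure_itv/= lte_fin ltr01 -EFinB/= subr0 mulr1.
Qed.

Lemma norm_itv (y : R) : - `|y| <= y <= `|y|.
Proof. by rewrite -ler_norml. Qed.

Lemma norm_itv0 (y : R) : - `|y| <= 0 <= `|y|.
Proof. by rewrite oppr_le0 normr_ge0. Qed.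

Lemma avgB k f g (y : R) : continuous f -> continuous g ->
  avg k f y - avg k g y = avg k (fun x => f x - g x) y.
Proof.
move=> cf cg; rewrite /avg -RintegralB//; last 2 first.
- by apply: avg_integrable (norm_itv0 y) (norm_itv y) _ => x _; exact: cf.
- by apply: avg_integrable (norm_itv0 y) (norm_itv y) _ => x _; exact: cg.
by apply: eq_Rintegral => u _; rewrite mulrBr.
Qed.

Lemma avg_le k h (y C : R) : continuous h ->
  (forall x, `|x| <= `|y| -> `|h x| <= C) -> `|avg k h y| <= C.
Proof.
move=> ch hC; rewrite /avg.
have yy := norm_itv y; have oo := norm_itv0 y.
have ii := @avg_integrable k h _ _ _ oo yy (fun x _ => ch x).
rewrite (le_trans (le_normr_Rintegral _ ii))//.
rewrite -[leRHS]Rintegral01_cst le_Rintegral//.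
- exact: integrable_norm ii.
- exact: integrable01_cst.
move=> u /=; rewrite in_itv/= => u01.
have /andP[u0 u1] := u01.
rewrite normrM [`|u ^+ k|]ger0_norm ?exprn_ge0//.
have := hC (u ^+ 2 * y); rewrite ler_norml (sqr_mul_itv u01 oo yy) => /(_ isT) H.
rewrite (le_trans _ H)// ler_piMl// exprn_ile1//.
Qed.

Lemma eq_avg k f g (e y : R) : e < 0 -> e < y ->
  (forall x, e < x -> f x = g x) -> avg k f y = avg k g y.
Proof.
move=> e0 ey fg; apply: eq_Rintegral => u; rewrite inE/= in_itv/= => /andP[u0 u1].
rewrite fg//; have u20 : 0 <= u ^+ 2 by rewrite exprn_ge0.
have u21 : u ^+ 2 <= 1 by rewrite exprn_ile1.
have [y0|y0] := leP 0 y; nra.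
Qed.

Let window (e y : R) : e < 0 -> e < y ->
  exists p q, [/\ e < p, p <= 0 <= q & p < y < q].
Proof.
move=> e0 ey; exists ((e + Num.min y 0) / 2), (`|y| + 1).
have := ler_norm y; have := normr_ge0 y; rewrite minEle.
by case: ifPn => y0; split; try lra.
Qed.

Lemma avg_continuous k h (e : R) : e < 0 ->
  (forall y, e < y -> {for y, continuous h}) ->
  forall y, e < y -> {for y, continuous (avg k h)}.
Proof.
move=> e0 ch y ey; have [p [q [ep pq ypq]]] := window e0 ey.
have ch' x : p <= x <= q -> {for x, continuous h}.
  by move=> /andP[px _]; apply: ch; exact: lt_le_trans px.
have [|C C0 hC] := bounded_on_itv _ ch'; first by move: pq; lra.
have W z : p < z < q -> p <= z <= q by lra.
apply: (@continuity_under_integral R _ _ mu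
  (fun (y u : R) => u ^+ k * h (u ^+ 2 * y)) `[0, 1] _ p q _ _ (fun=> C)).
- exact: measurable_itv.
- by move=> z /=; rewrite in_itv/= => /W zpq; exact: avg_integrable pq zpq ch'.
- apply: aeW => u /=; rewrite in_itv/= => u01 z; rewrite inE/= in_itv/= => /W zpq.
  change {for z, continuous (fun y : R => u ^+ k * h (u ^+ 2 * y))}.
  apply: continuousM; first exact: cst_continuous.
  apply: (@continuous_comp _ _ _ (fun z : R => u ^+ 2 * z) h).
    by apply: continuousM; [exact: cst_continuous|exact: cvg_id].
  exact/ch'/sqr_mul_itv.
- exact: integrable01_cst.
- move=> z /=; rewrite in_itv/= => /W zpq.
  apply: aeW => u /=; rewrite in_itv/= => u01; have /andP[u0 u1] := u01.
  rewrite normrM [`|u ^+ k|]ger0_norm ?exprn_ge0//.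
  rewrite (le_trans _ (hC _ (sqr_mul_itv u01 pq zpq)))// ler_piMl// exprn_ile1//.
- by rewrite inE/= in_itv.
Qed.

Lemma avg_derive k h h' (e : R) : e < 0 ->
  (forall y, e < y -> is_derive y (1 : R) h (h' y)) ->
  (forall y, e < y -> {for y, continuous h'}) ->
  forall y, e < y -> is_derive y (1 : R) (avg k h) (avg k.+2 h' y).
Proof.
move=> e0 dh ch' y ey; have [p [q [ep pq ypq]]] := window e0 ey.
have W z : p < z < q -> p <= z <= q by lra.
have Wh z : p <= z <= q -> is_derive z (1 : R) h (h' z).
  by move=> /andP[px _]; apply: dh; exact: lt_le_trans px.
have ch x : p <= x <= q -> {for x, continuous h} by move=> /Wh /D1_continuous.
have cp' x : p <= x <= q -> {for x, continuous h'}.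
  by move=> /andP[px _]; apply: ch'; exact: lt_le_trans px.
have [|C C0 hC] := bounded_on_itv _ cp'; first by move: pq; lra.
have dd (z u : R) : p <= z <= q -> 0 <= u <= 1 -> is_derive z (1 : R)
    (fun y : R => u ^+ k * h (u ^+ 2 * y)) (u ^+ k.+2 * h' (u ^+ 2 * z)).
  move=> zpq u01; have D1 : is_derive z (1 : R) (fun y : R => u ^+ 2 * y) (u ^+ 2).
    by Dsolve; ring.
  have D2 := D1_comp (Wh _ (sqr_mul_itv u01 pq zpq)) D1.
  eapply D1_eq; [exact: D1_mul (D1_cst _ _) D2|].
  by rewrite /= mulr0 addr0 !exprS; ring.
have inty (z : R) : p < z < q ->
    mu.-integrable `[0, 1] (EFin \o (fun u : R => u ^+ k * h (u ^+ 2 * z))).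
  by move=> /W zpq; exact: avg_integrable pq zpq ch.
have dbl (z u : R) : z \in `]p, q[ -> u \in `[0, 1] ->
    derivable (fun y : R => u ^+ k * h (u ^+ 2 * y)) z 1.
  by rewrite !in_itv/= => /W /dd H /H [].
have dE (z u : R) : z \in `]p, q[ -> u \in `[0, 1] ->
    partial1of2 (fun y u : R => u ^+ k * h (u ^+ 2 * y)) z u =
    u ^+ k.+2 * h' (u ^+ 2 * z).
  by rewrite !in_itv/= => /W /dd H /H [] _ <-; rewrite partial1of2E.
have ub (z u : R) : z \in `]p, q[ -> u \in `[0, 1] ->
    `|partial1of2 (fun y u : R => u ^+ k * h (u ^+ 2 * y)) z u| <= C.
  move=> zpq u01; rewrite dE//.
  move: zpq u01; rewrite !in_itv/= => /W zpq u01; have /andP[u0 u1] := u01.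
  rewrite normrM [`|u ^+ k.+2|]ger0_norm ?exprn_ge0//.
  by rewrite (le_trans _ (hC _ (sqr_mul_itv u01 pq zpq)))// ler_piMl// exprn_ile1.
have Iy : y \in `]p, q[ by rewrite in_itv.
have inty' (z : R) : z \in `]p, q[ ->
    mu.-integrable `[0, 1] (EFin \o (fun u : R => u ^+ k * h (u ^+ 2 * z))).
  by rewrite in_itv/=; exact: inty.
split.
  exact: (@derivable_under_integral R _ _ mu _ _ (measurable_itv _) y p q Iy
    inty' dbl (fun=> C) (fun=> C0) (integrable01_cst C) ub).
rewrite -derive1E (@differentiation_under_integral R _ _ mu _ _ (measurable_itv _)
  y p q Iy inty' dbl (fun=> C) (fun=> C0) (integrable01_cst C) ub).
by apply: eq_Rintegral => u; rewrite inE => u01; rewrite dE.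
Qed.

Lemma radial_avg_derive k h : continuous h -> forall r : R,
  is_derive r (1 : R) (fun r : R => r ^+ k.+1 * avg k h (r ^+ 2)) (r ^+ k * h (r ^+ 2)).
Proof.
move=> ch r.
have [|P [P0 dP]] := @exists_primitive R (fun v : R => v ^+ k * h (v ^+ 2)).
  move=> v; change {for v, continuous (fun v : R => v ^+ k * h (v ^+ 2))}.
  apply: continuousM; first exact: exprn_continuous.
  apply: (@continuous_comp _ _ _ (fun v : R => v ^+ 2) h); last exact: ch.
  exact: exprn_continuous.
suff -> : (fun r : R => r ^+ k.+1 * avg k h (r ^+ 2)) = P by exact: dP.
apply/funext => s.
have D1 (u : R) : is_derive u (1 : R) (fun u : R => u * s) s.
  by Dsolve; ring.
have D2 (u : R) : is_derive u (1 : R) (fun u : R => P (u * s))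
    (s ^+ k.+1 * (u ^+ k * h (u ^+ 2 * s ^+ 2))).
  by apply: D1_eq (D1_comp (dP _) (D1 u)) _; rewrite /= !exprMn (exprS s k); ring.
have c3 : continuous (fun u : R => s ^+ k.+1 * (u ^+ k * h (u ^+ 2 * s ^+ 2))).
  move=> u.
  change {for u, continuous (fun u : R => s ^+ k.+1 * (u ^+ k * h (u ^+ 2 * s ^+ 2)))}.
  apply: continuousM; first exact: cst_continuous.
  apply: continuousM; first exact: exprn_continuous.
  apply: (@continuous_comp _ _ _ (fun u : R => u ^+ 2 * s ^+ 2) h); last exact: ch.
  by apply: continuousM; [exact: exprn_continuous|exact: cst_continuous].
rewrite /avg -RintegralZl//; last first.
  have oo : - s ^+ 2 <= 0 <= s ^+ 2 by rewrite oppr_le0 sqr_ge0.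
  by apply: avg_integrable oo _ (fun x _ => ch x); have := sqr_ge0 s; lra.
have c4 u : {for u, continuous (fun u : R => P (u * s))} by exact: D1_continuous (D2 u).
rewrite /Rintegral (@continuous_FTC2 R _ (fun u : R => P (u * s)))//.
- by rewrite -EFinB/= mul1r mul0r P0 subr0.
- exact: continuous_subspaceT.
- split.
  + by move=> u _; have [] := D2 u.
  + by apply: cvg_at_right_filter; exact: c4.
  + by apply: cvg_at_left_filter; exact: c4.
- by move=> u _; rewrite derive1E; have [_ ->] := D2 u.
Qed.

End radial_average.

(** * Picard iteration *)

Section picard.
Context {R : realType}.

Lemma geometric_limit (u : nat -> R) (C : R) :
  (forall n, `|u n.+1 - u n| <= C * 2^-1 ^+ n) ->
  exists l, forall n, `|u n - l| <= 2 * C * 2^-1 ^+ n.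
Proof.
move=> hu.
pose v n := u n - 2 * C * 2^-1 ^+ n; pose w n := u n + 2 * C * 2^-1 ^+ n.
have vS n : v n <= v n.+1.
  by have := hu n; rewrite ler_norml /v exprS; lra.
have wS n : w n.+1 <= w n.
  by have := hu n; rewrite ler_norml /w exprS; lra.
have vw0 n : v n <= w n by have := vS n; have := wS n; have := hu n;
  rewrite ler_norml /v /w exprS; lra.
have vm m n : (m <= n)%N -> v m <= v n.
  by move=> /subnK <-; elim: (n - m)%N => // k /le_trans; apply.
have wm m n : (m <= n)%N -> w n <= w m.
  by move=> /subnK <-; elim: (n - m)%N => // k IH; exact: le_trans (wS _) IH.
have vw m n : v m <= w n.
  apply: (le_trans (vm m (maxn m n) (leq_maxl _ _))).
  exact: le_trans (vw0 _) (wm _ _ (leq_maxr _ _)).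
have vub : has_sup (range v).
  by split; [exists (v 0%N); exists 0%N|exists (w 0%N) => _ [n _ <-]].
exists (sup (range v)) => n.
have h1 : v n <= sup (range v) by apply: sup_upper_bound => //; exists n.
have h2 : sup (range v) <= w n by apply: ge_sup; [case: vub|move=> _ [m _ <-]].
rewrite ler_norml; move: h1 h2; rewrite /v /w; lra.
Qed.

Lemma uniform_limit_continuous (f : nat -> R -> R) (g w : R -> R) :
  (forall n, continuous (f n)) -> continuous w ->
  (forall n x, `|f n x - g x| <= w x * 2^-1 ^+ n) -> continuous g.
Proof.
move=> cf cw fg x.
have W0 z : 0 <= w z by have := fg 0%N z; rewrite expr0 mulr1; apply: le_trans.
apply/cvgrPdist_le => e e0.
pose M := w x + 1; have M0 : 0 < M by rewrite ltr_wpDl.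
have [n hn] : exists n, M * 2^-1 ^+ n <= e / 4.
  have : (fun n => M * 2^-1 ^+ n) @ \oo --> M * (0 : R).
    by apply: cvgM; [exact: cvg_cst|apply: cvg_expr; rewrite gtr0_norm; lra].
  rewrite mulr0 => /cvgr0_norm_le /(_ (e / 4)) [|N _ /(_ N (leqnn N))]; first lra.
  by move=> h; exists N; rewrite (le_trans (ler_norm _)).
near=> z.
have wz : w z <= M.
  by near: z; apply: (cvgr_le (w x)); [exact: cw|rewrite ltrDl].
have fz : `|f n x - f n z| <= e / 4.
  by near: z; apply: cvgr_dist_le; [exact: cf|lra].
have p0 : 0 <= (2^-1 : R) ^+ n by rewrite exprn_ge0.
have h1 := fg n x; have h2 := fg n z.
have h3 : w x * 2^-1 ^+ n <= M * 2^-1 ^+ n.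
  by apply: ler_wpM2r => //; rewrite lerDl.
have h4 : w z * 2^-1 ^+ n <= M * 2^-1 ^+ n by apply: ler_wpM2r.
move: h1 h2 fz; rewrite !ler_norml; lra.
Unshelve. all: by end_near. Qed.

Variables c0 c1 : R.
Hypotheses (c0_ge0 : 0 <= c0) (c1_ge0 : 0 <= c1).

Let W (y : R) : R := expR (2 * c0 * y + c1 * y ^+ 2).

Let W_mono (x y : R) : 0 <= x -> x <= y -> W x <= W y.
Proof. by move=> x0 xy; rewrite ler_expR lerD// ler_wpM2l// ?mulr_ge0// ler_sqr// nnegrE (le_trans x0). Qed.

Let W_ge1 (y : R) : 0 <= y -> 1 <= W y.
Proof.
move=> y0; have := W_mono (lexx 0) y0; rewrite {1}/W.
by rewrite expr0n/= !mulr0 addr0 expR0.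
Qed.

Let DW (y : R) : is_derive y (1 : R) W (2 * (c0 + c1 * y) * W y).
Proof. by rewrite /W; Dsolve; ring. Qed.

(* A Bielecki weight: [W' = 2 L W], so integrating [L W] costs a factor 1/2. *)
Let weight_bound (f f' : R -> R) (c y : R) : 0 <= c -> f 0 = 0 ->
  (forall y, is_derive y (1 : R) f (f' y)) ->
  (forall y, `|f' y| <= c * ((c0 + c1 * `|y|) * W `|y|)) ->
  `|f y| <= c / 2 * W `|y|.
Proof.
have pos (h h' : R -> R) (b x : R) : 0 <= b -> 0 <= x -> h 0 = 0 ->
  (forall y, is_derive y (1 : R) h (h' y)) ->
  (forall y, 0 <= y -> h' y <= b * ((c0 + c1 * y) * W y)) ->
  h x <= b / 2 * W x.
  move=> b0 x0 h0 dh hb.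
  have D y' : is_derive y' (1 : R) (fun y => h y - b / 2 * W y)
      (h' y' - b * ((c0 + c1 * y') * W y')).
    by have d1 := dh y'; have d2 := DW y'; Dsolve; field.
  have := @le_of_derive_le0 R _ _ 0 x x0 (fun y _ => D1_continuous (D y))
     (fun y _ => D y); rewrite h0 sub0r => K.
  have : h x - b / 2 * W x <= - (b / 2 * W 0).
    apply: K => z /andP[/ltW z0 _]; rewrite subr_le0; exact: hb.
  have : 0 <= b / 2 * W 0 by rewrite mulr_ge0 ?expR_ge0 ?divr_ge0.
  lra.
move=> c_ge0 f0 df fb.
wlog y0 : f f' y f0 df fb / 0 <= y.
  move=> H; have [y0|/ltW y0] := leP 0 y; first exact: (H f f' y f0 df fb y0).
  have := H (fun y => f (- y)) (fun y => - f' (- y)) (- y).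
  rewrite normrN opprK; apply; last by rewrite oppr_ge0.
  - by rewrite oppr0.
  - move=> z; have d1 : is_derive z (1 : R) (fun z : R => - z) (- 1).
      by Dsolve.
    by apply: D1_eq (D1_comp (df _) d1) _; rewrite mulrN1.
  - by move=> z; rewrite normrN -[`|z|]normrN.
rewrite (ger0_norm y0) ler_norml lerNl; apply/andP; split.
- apply: (pos (fun y => - f y) (fun y => - f' y)) => //; first by rewrite f0 oppr0.
  + move=> z z0; have := fb z; rewrite (ger0_norm z0); apply: le_trans.
    by rewrite -normrN ler_norm.
- apply: (pos f f') => // z z0; have := fb z; rewrite (ger0_norm z0).
  by apply: le_trans; exact: ler_norm.
Qed.

Variables (k : nat) (P1 P2 : R -> R -> R -> R).
Let field_ok (P : R -> R -> R -> R) :=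
  [/\ forall a b : R -> R, continuous a -> continuous b ->
        continuous (fun y => P y (a y) (b y)),
      forall y, P y 0 0 = 0 &
      forall y a b a' b', `|P y a b - P y a' b'| <=
        (c0 + c1 * `|y|) * (`|a - a'| + `|b - b'|)].
Hypotheses (P1_ok : field_ok P1) (P2_ok : field_ok P2).

Let rhs (P : R -> R -> R -> R) (a b : R -> R) (y : R) : R :=
  - (2^-1 * avg k (fun x => P x (a x) (b x)) y).

Let rhs_continuous P a b : field_ok P -> continuous a -> continuous b ->
  continuous (rhs P a b).
Proof.
move=> [cP _ _] ca cb y.
change {for y, continuous (rhs P a b)}.
apply: continuousN; apply: continuousM; first exact: cst_continuous.
apply: (@avg_continuous R k _ (- `|y| - 1)).
- by have := normr_ge0 y; lra.
- by move=> z _; exact: cP.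
- by have := norm_itv y; lra.
Qed.

Let rhs_bound P a b a' b' (M y : R) : field_ok P -> 0 <= M ->
  continuous a -> continuous b -> continuous a' -> continuous b' ->
  (forall x, `|a x - a' x| + `|b x - b' x| <= M * W `|x|) ->
  `|rhs P a b y - rhs P a' b' y| <= M / 2 * ((c0 + c1 * `|y|) * W `|y|).
Proof.
move=> [cP _ lP] M0 ca cb ca' cb' hM.
have c1P := cP _ _ ca cb; have c2P := cP _ _ ca' cb'.
rewrite /rhs -opprB normrN opprK addrC -mulrBr avgB// normrM ger0_norm ?invr_ge0//.
rewrite (_ : M / 2 * _ = 2^-1 * (M * ((c0 + c1 * `|y|) * W `|y|))); last by ring.
rewrite ler_wpM2l ?invr_ge0//; apply: avg_le.
  by move=> z; apply: continuousB; [exact: c1P|exact: c2P].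
move=> x xy; apply: (le_trans (lP _ _ _ _ _)).
rewrite mulrCA; apply: ler_pM => //.
- by rewrite addr_ge0// mulr_ge0.
- by rewrite lerD2l ler_wpM2l.
- by apply: (le_trans (hM _)); rewrite ler_wpM2l// W_mono.
Qed.

Let step P a b A0 (aP : field_ok P) (ca : continuous a) (cb : continuous b) :
  {f : R -> R | f 0 = A0 /\ forall y, is_derive y (1 : R) f (rhs P a b y)}.
Proof.
apply: cid; have [f [f0 df]] := exists_primitive (rhs_continuous aP ca cb).
exists (fun y => A0 + f y); split; first by rewrite f0 addr0.
by move=> y; have d1 := df y; Dsolve; rewrite add0r.
Qed.

Lemma picard_existence (A0 B0 : R) : exists a b : R -> R,
  [/\ a 0 = A0, b 0 = B0,
      forall y, is_derive y (1 : R) a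
        (- (2^-1 * avg k (fun x => P1 x (a x) (b x)) y)) &
      forall y, is_derive y (1 : R) b
        (- (2^-1 * avg k (fun x => P2 x (a x) (b x)) y))].
Proof.
pose T := {ab : (R -> R) * (R -> R) | continuous ab.1 /\ continuous ab.2}.
have Dc (f f' : R -> R) : (forall y, is_derive y (1 : R) f (f' y)) -> continuous f.
  by move=> df y; exact: D1_continuous (df y).
pose next (s : T) : T :=
  let c := svalP s in
  let f := step A0 P1_ok c.1 c.2 in let g := step B0 P2_ok c.1 c.2 in
  exist _ (sval f, sval g) (conj (Dc _ _ (svalP f).2) (Dc _ _ (svalP g).2)).
have c00 : continuous (fun _ : R => 0 : R) by move=> x; exact: cst_continuous.
pose s0 : T := exist _ (fun=> 0, fun=> 0) (conj c00 c00).
pose s n := iter n next s0.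
pose a n := (sval (s n)).1; pose b n := (sval (s n)).2.
have ca n : continuous (a n) by exact: (svalP (s n)).1.
have cb n : continuous (b n) by exact: (svalP (s n)).2.
have aS n : a n.+1 0 = A0 /\
    forall y, is_derive y (1 : R) (a n.+1) (rhs P1 (a n) (b n) y).
  exact: (svalP (step A0 P1_ok (svalP (s n)).1 (svalP (s n)).2)).
have bS n : b n.+1 0 = B0 /\
    forall y, is_derive y (1 : R) (b n.+1) (rhs P2 (a n) (b n) y).
  exact: (svalP (step B0 P2_ok (svalP (s n)).1 (svalP (s n)).2)).
pose M := `|A0| + `|B0|.
have M0 : 0 <= M by rewrite addr_ge0.
have contr P f f' u v u' v' C0 (C y : R) : field_ok P -> 0 <= C ->
    continuous u -> continuous v -> continuous u' -> continuous v' ->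
    (forall x, `|u x - u' x| + `|v x - v' x| <= C * W `|x|) ->
    f 0 = C0 -> f' 0 = C0 ->
    (forall y, is_derive y (1 : R) f (rhs P u v y)) ->
    (forall y, is_derive y (1 : R) f' (rhs P u' v' y)) ->
    `|f y - f' y| <= C / 4 * W `|y|.
  move=> okP C0' cu cv cu' cv' uv f0 f'0 df df'.
  rewrite (_ : C / 4 = C / 2 / 2); last by field.
  apply: (@weight_bound (fun y => f y - f' y)
    (fun y => rhs P u v y - rhs P u' v' y)).
  - by rewrite divr_ge0.
  - by rewrite f0 f'0 subrr.
  - by move=> z; exact: rhs_bound.
have diff n y : `|a n.+1 y - a n y| + `|b n.+1 y - b n y| <=
    M * 2^-1 ^+ n * W `|y|.
  elim: n y => [|n IH] y.
    rewrite expr0 mulr1.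
    have z1 x : P1 x 0 0 = 0 by case: P1_ok.
    have z2 x : P2 x 0 0 = 0 by case: P2_ok.
    have r1 : rhs P1 (a 0%N) (b 0%N) = fun=> 0.
      by apply/funext => x; rewrite /rhs /avg; under eq_Rintegral do rewrite z1 mulr0;
        rewrite Rintegral01_cst mulr0 oppr0.
    have r2 : rhs P2 (a 0%N) (b 0%N) = fun=> 0.
      by apply/funext => x; rewrite /rhs /avg; under eq_Rintegral do rewrite z2 mulr0;
        rewrite Rintegral01_cst mulr0 oppr0.
    have -> : a 1%N y = A0.
      have [<- da] := aS 0%N; rewrite r1 in da.
      exact: is_derive_0_is_cst.
    have -> : b 1%N y = B0.
      have [<- db] := bS 0%N; rewrite r2 in db.
      exact: is_derive_0_is_cst.
    by rewrite !subr0 -/M ler_peMr// W_ge1.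
  have C0 : 0 <= M * 2^-1 ^+ n by rewrite mulr_ge0// exprn_ge0.
  have [a1 da1] := aS n; have [a2 da2] := aS n.+1.
  have [b1 db1] := bS n; have [b2 db2] := bS n.+1.
  have h1 := contr _ _ _ _ _ _ _ _ _ y P1_ok C0 (ca n.+1) (cb n.+1) (ca n) (cb n) IH
    a2 a1 da2 da1.
  have h2 := contr _ _ _ _ _ _ _ _ _ y P2_ok C0 (ca n.+1) (cb n.+1) (ca n) (cb n) IH
    b2 b1 db2 db1.
  apply: (le_trans (lerD h1 h2)); rewrite exprS -mulrDl.
  by rewrite ler_wpM2r ?expR_ge0//; lra.
have {}diff n y : `|a n.+1 y - a n y| <= M * W `|y| * 2^-1 ^+ n /\
    `|b n.+1 y - b n y| <= M * W `|y| * 2^-1 ^+ n.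
  have := diff n y; rewrite mulrAC.
  have := normr_ge0 (a n.+1 y - a n y); have := normr_ge0 (b n.+1 y - b n y); lra.
have /choice[al ha] y := geometric_limit (fun n => (diff n y).1).
have /choice[bl hb] y := geometric_limit (fun n => (diff n y).2).
have cW : continuous (fun y : R => 2 * (M * W `|y|)).
  move=> y; change {for y, continuous (fun y : R => 2 * (M * W `|y|))}.
  apply: continuousM; first exact: cst_continuous.
  apply: continuousM; first exact: cst_continuous.
  apply: (@continuous_comp R R R (fun x : R => `|x|) W); first exact: norm_continuous.
  exact: D1_continuous (DW _).
have cal : continuous al by exact: (uniform_limit_continuous ca cW (fun n x => ha x n)).
have cbl : continuous bl by exact: (uniform_limit_continuous cb cW (fun n x => hb x n)).
have lim n x : `|a n x - al x| + `|b n x - bl x| <= (4 * M * 2^-1 ^+ n) * W `|x|.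
  by have := ha x n; have := hb x n; lra.
have fixp P f l C0 : field_ok P -> (forall n, f n.+1 0 = C0) ->
    (forall n y, is_derive y (1 : R) (f n.+1) (rhs P (a n) (b n) y)) ->
    (forall y n, `|f n y - l y| <= 2 * (M * W `|y|) * 2^-1 ^+ n) ->
    l 0 = C0 /\ forall y, is_derive y (1 : R) l (rhs P al bl y).
  move=> okP f0 df fl.
  have [g [g0 dg]] := step C0 okP cal cbl.
  suff -> : l = g by [].
  apply/funext => y.
  have bd n : `|l y - g y| <= 2 * M * W `|y| * 2^-1 ^+ n.
    have C1 : 0 <= 4 * M * 2^-1 ^+ n by rewrite !mulr_ge0// exprn_ge0.
    have h1 := contr _ _ _ _ _ _ _ _ _ y okP C1 (ca n) (cb n) cal cbl (lim n)
      (f0 n) g0 (df n) dg.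
    have h2 := fl y n.+1; rewrite exprS in h2.
    have := ler_distD (f n.+1 y) (l y) (g y).
    rewrite (distrC (l y) (f n.+1 y)).
    move: h1 h2; lra.
  have lim0 : (fun n => 2 * M * W `|y| * 2^-1 ^+ n) @ \oo --> 2 * M * W `|y| * (0 : R).
    by apply: cvgM; [exact: cvg_cst|apply: cvg_expr; rewrite gtr0_norm; lra].
  have : `|l y - g y| <= 2 * M * W `|y| * 0.
    rewrite -(cvg_lim _ lim0)//; apply: limr_ge; first by apply/cvg_ex; eexists; exact: lim0.
    exact: nearW.
  by rewrite mulr0 normr_le0 subr_eq0 => /eqP.
have [al0 dal] := fixp P1 a al A0 P1_ok (fun n => (aS n).1) (fun n => (aS n).2) ha.
have [bl0 dbl] := fixp P2 b bl B0 P2_ok (fun n => (bS n).1) (fun n => (bS n).2) hb.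
by exists al, bl.
Qed.

End picard.

(** * Energy estimates for the profile equation *)

Section profile_estimates.
Context {R : realType}.
Variables (d : nat) (beta : R).
Hypotheses (d_gt0 : (0 < d)%N) (beta_gt0 : 0 < beta).

Definition radial_solution (g q1 q2 z1 z2 : R -> R) :=
  [/\ q1 0 = 1 /\ q2 0 = 0,
      [/\ continuous q1, continuous q2, continuous z1 & continuous z2],
      forall r : R, 0 < r -> is_derive r (1 : R) q1 (2 * r * z1 r) /\
        is_derive r (1 : R) q2 (2 * r * z2 r),
      forall r : R, 0 < r -> is_derive r (1 : R) z1
        (- (d%:R * z1 r + 2^-1 * ((r ^+ 2 / 16 + g (q1 r ^+ 2 + q2 r ^+ 2)) * q1 r
             - beta * q2 r)) / r) &
      forall r : R, 0 < r -> is_derive r (1 : R) z2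
        (- (d%:R * z2 r + 2^-1 * ((r ^+ 2 / 16 + g (q1 r ^+ 2 + q2 r ^+ 2)) * q2 r
             + beta * q1 r)) / r)].

Let d1 : (1 : R) <= d%:R. Proof. by rewrite ler1n. Qed.

(* The angular momentum [r^d (q1 z2 - q2 z1)] is strictly decreasing as long as
   the solution does not vanish identically. *)
Lemma radial_solution_neq0 g q1 q2 z1 z2 : radial_solution g q1 q2 z1 z2 ->
  forall r, 0 <= r -> 0 < q1 r ^+ 2 + q2 r ^+ 2.
Proof.
move=> [[q10 q20] [cq1 cq2 cz1 cz2] dq dz1 dz2] r0 r0_ge0.
have [r0_gt0|r0_le0] := ltP 0 r0; last first.
  have -> : r0 = 0 by apply/eqP; rewrite eq_le r0_le0.
  by rewrite q10 q20 expr1n expr0n addr0.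
rewrite lt_neqAle addr_ge0 ?sqr_ge0// andbT eq_sym; apply/eqP => s0.
have [q1r0 q2r0] : q1 r0 = 0 /\ q2 r0 = 0.
  by split; apply/eqP; rewrite -sqrf_eq0; apply/eqP;
    have := sqr_ge0 (q1 r0); have := sqr_ge0 (q2 r0); lra.
pose om r := r ^+ d * (q1 r * z2 r - q2 r * z1 r).
have com (r : R) : {for r, continuous om}.
  apply: continuousM; first exact: exprn_continuous.
  by apply: continuousB; apply: continuousM;
    [exact: cq1|exact: cz2|exact: cq2|exact: cz1].
have dom (r : R) : 0 < r -> is_derive r (1 : R) om
    (- (beta / 2 * r ^+ d.-1 * (q1 r ^+ 2 + q2 r ^+ 2))).
  move=> r_gt0; have [a1 a2] := dq r r_gt0; have a3 := dz1 r r_gt0.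
  have a4 := dz2 r r_gt0; rewrite /om; Dsolve.
  have -> : r ^+ d = r * r ^+ d.-1 by rewrite -exprS prednK.
  by field; rewrite gt_eqF.
have om_le r : 0 <= r <= r0 -> om r = 0.
  move=> /andP[r_ge0 rr0].
  have h1 : om r <= om 0.
    apply: (le_of_derive_le0 r_ge0 (fun x _ => com x)).
      by move=> x /andP[x0 _]; exact: dom.
    move=> x /andP[x0 _]; rewrite oppr_le0 mulr_ge0 ?addr_ge0 ?sqr_ge0//.
    by rewrite mulr_ge0 ?exprn_ge0 ?divr_ge0// ltW.
  have h2 : om r0 <= om r.
    apply: (le_of_derive_le0 rr0 (fun x _ => com x)).
      by move=> x /andP[x0 _]; apply: dom; exact: le_lt_trans x0.
    move=> x /andP[x0 _]; have {}x0 := le_lt_trans r_ge0 x0.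
    rewrite oppr_le0 mulr_ge0 ?addr_ge0 ?sqr_ge0//.
    by rewrite mulr_ge0 ?exprn_ge0 ?divr_ge0// ltW.
  have e0 : om 0 = 0 by rewrite /om expr0n gtn_eqF// mul0r.
  have e1 : om r0 = 0 by rewrite /om q1r0 q2r0 !mul0r subr0 mulr0.
  by apply/eqP; rewrite eq_le -{1}e0 h1 -e1 h2.
have cs : {for (0 : R), continuous (fun r => q1 r ^+ 2 + q2 r ^+ 2)}.
  by apply: continuousD; apply: (@continuous_comp _ _ _ _ (fun x : R => x ^+ 2));
    [exact: cq1|exact: exprn_continuous|exact: cq2|exact: exprn_continuous].
have : \forall r \near (0 : R), 0 < q1 r ^+ 2 + q2 r ^+ 2.
  by apply: (cvgr_gt _ cs); rewrite q10 q20 expr1n expr0n addr0.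
move=> /nbhs_ballP[e /= e0 he].
pose r1 := Num.min r0 (e / 2).
have r10 : 0 < r1 by rewrite lt_min r0_gt0 divr_gt0.
have r1e : r1 < e by rewrite /r1 gt_min; apply/orP; right; lra.
have r1r0 : r1 <= r0 by rewrite ge_min lexx.
have [||c] := @MVT R om (fun r => - (beta / 2 * r ^+ d.-1 * (q1 r ^+ 2 + q2 r ^+ 2))) 0 r1 r10.
- by move=> x; rewrite in_itv/= => /andP[x0 _]; exact: dom.
- by apply: continuous_subspaceT => x; exact: com.
rewrite in_itv/= => /andP[c0 cr1].
rewrite !om_le ?lexx ?(ltW r0_gt0) ?(ltW r10)//.
have sc : 0 < q1 c ^+ 2 + q2 c ^+ 2.
  by apply: he; rewrite /ball/= sub0r normrN gtr0_norm// (lt_trans cr1).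
have : 0 < beta / 2 * c ^+ d.-1 * (q1 c ^+ 2 + q2 c ^+ 2) * (r1 - 0).
  by rewrite subr0 !mulr_gt0// exprn_gt0.
lra.
Qed.

Section energy.
Variables (g G q1 q2 z1 z2 : R -> R).
Hypothesis sol : radial_solution g q1 q2 z1 z2.
Hypotheses (dG : forall s : R, is_derive s (1 : R) G (g s))
  (G_ge0 : forall s, 0 <= s -> 0 <= G s)
  (G_le : forall s, 0 <= s -> G s <= s * g s)
  (G1 : G 1 <= 1).

Let s r := q1 r ^+ 2 + q2 r ^+ 2.
Let zz r := z1 r ^+ 2 + z2 r ^+ 2.
Let w r := q1 r * z2 r - q2 r * z1 r.
Let qz r := q1 r * z1 r + q2 r * z2 r.
Let N r := 4 * r ^+ 2 * zz r + (r ^+ 2 / 16 + 1) * s r + G (s r).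
Let M r := 4 * r ^+ 2 * zz r + r ^+ 2 / 16 * s r + G (s r) + 2 * d%:R * qz r.

Let s_ge0 r : 0 <= s r. Proof. by rewrite addr_ge0 ?sqr_ge0. Qed.
Let zz_ge0 r : 0 <= zz r. Proof. by rewrite addr_ge0 ?sqr_ge0. Qed.

Let c := d%:R / 4 + 2 * beta + 2.

Let small_bound (r : R) : 0 <= r <= 2 * d%:R -> N r <= 2 * expR (c * (2 * d%:R)).
Proof.
move=> /andP[r_ge0 rd].
have [[q10 q20] [cq1 cq2 cz1 cz2] dq dz1 dz2] := sol.
have D1 := d1.
have dN (x : R) : 0 < x -> is_derive x (1 : R) N
    (2 * x * ((4 - 4 * d%:R) * zz x + s x / 16 - 2 * beta * w x) + 4 * x * qz x).
  move=> x0; have [a1 a2] := dq x x0; have a3 := dz1 x x0; have a4 := dz2 x x0.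
  have a5 : is_derive x (1 : R) (fun x => G (q1 x ^+ 2 + q2 x ^+ 2))
      (g (s x) * (4 * x * qz x)).
    by apply: (@D1_comp _ G); rewrite /s /qz; Dsolve; ring.
  rewrite /N /zz /s /w /qz in a5 *; Dsolve.
  by field; rewrite gt_eqF.
have cN (x : R) : {for x, continuous N}.
  have sq (f : R -> R) : continuous f -> {for x, continuous (fun x => f x ^+ 2)}.
    move=> cf; apply: (@continuous_comp _ _ _ f (fun x : R => x ^+ 2)).
      exact: cf.
    exact: exprn_continuous.
  have cx2 : {for x, continuous (fun x : R => x ^+ 2)} by exact: exprn_continuous.
  have cs : {for x, continuous s} by apply: continuousD; exact: sq.
  apply: continuousD; last first.
    by apply: (@continuous_comp _ _ _ s G) => //; exact: D1_continuous (dG _).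
  apply: continuousD; apply: continuousM => //.
  - by apply: continuousM => //; exact: cst_continuous.
  - by apply: continuousD; exact: sq.
  - apply: continuousD; last exact: cst_continuous.
    by apply: continuousM => //; exact: cst_continuous.
pose P x := N x * expR (- (c * x)).
have dE (x : R) : is_derive x (1 : R) (fun x => expR (- (c * x)))
    (- c * expR (- (c * x))) by Dsolve; ring.
pose P' x := (2 * x * ((4 - 4 * d%:R) * zz x + s x / 16 - 2 * beta * w x)
  + 4 * x * qz x - c * N x) * expR (- (c * x)).
have cP (x : R) : {for x, continuous P}.
  by apply: continuousM; [exact: cN|exact: D1_continuous (dE x)].
have dP (x : R) : 0 < x -> is_derive x (1 : R) P (P' x).
  by move=> x0; have a1 := dN x x0; have a2 := dE x; rewrite /P /P'; Dsolve; ring.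
have : P r <= P 0.
  apply: (le_of_derive_le0 r_ge0 (fun x _ => cP x)
    (fun x (xr : 0 < x < r) => dP x (proj1 (andP xr)))).
  move=> x /andP[x0 xr].
  rewrite /P' pmulr_lle0 ?expR_gt0// subr_le0.
  have sx := s_ge0 x; have zx := zz_ge0 x; have Gx := G_ge0 sx.
  have h1 : - (2 * x * w x) <= s x + x ^+ 2 * zz x.
    rewrite /w /s /zz; have := sqr_ge0 (q1 x + x * z2 x).
    have := sqr_ge0 (q2 x - x * z1 x); nra.
  have h2 : 2 * x * qz x <= s x + x ^+ 2 * zz x.
    rewrite /qz /s /zz; have := sqr_ge0 (q1 x - x * z1 x).
    have := sqr_ge0 (q2 x - x * z2 x); nra.
  have xz : 0 <= x ^+ 2 * zz x by rewrite mulr_ge0// sqr_ge0.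
  have xs : 0 <= x ^+ 2 * s x by rewrite mulr_ge0// sqr_ge0.
  have h3 : s x + x ^+ 2 * zz x <= N x by rewrite /N; lra.
  have h4 : s x <= N x by lra.
  have h5 : x * s x <= 2 * d%:R * N x.
    by apply: ler_pM => //; [exact: ltW|lra].
  have h6 : 2 * beta * (- (2 * x * w x)) <= 2 * beta * N x.
    by rewrite ler_pM2l ?mulr_gt0//; lra.
  have h7 : 2 * x * (4 - 4 * d%:R) * zz x <= 0.
    have : 0 <= x * (d%:R - 1) * zz x by rewrite !mulr_ge0 ?subr_ge0// ltW.
    lra.
  rewrite /c; lra.
have N0 : N 0 = 1 + G 1.
  by rewrite /N /s q10 q20 expr1n expr0n/= addr0; ring.
rewrite /P mulr0 oppr0 expR0 mulr1 N0 => h.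
have {}h : N r <= 2 * expR (c * r).
  rewrite -(ler_pM2r (expR_gt0 (- (c * r)))) -mulrA -expRD subrr expR0.
  by have := G1; lra.
apply: (le_trans h); rewrite ler_pM2l// ler_expR ler_pM2l//.
by rewrite /c addr_gt0// ?addr_gt0 ?mulr_gt0 ?divr_gt0//; lra.
Qed.

Let m2 := 2 - d%:R + 4 * beta.
Let C1 := `|2 * m2 * d%:R + 2 * d%:R ^+ 2|.

Let E0_le (r : R) : 2 * d%:R <= r ->
  4 * r ^+ 2 * zz r + r ^+ 2 / 16 * s r <= 2 * M r /\ 0 <= M r.
Proof.
move=> rd; set E0 := _ + _.
have r2 : 4 * d%:R <= r ^+ 2 by have := d1; nra.
have E0_ge0 : 0 <= E0.
  apply: addr_ge0; apply: mulr_ge0 => //.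
    by rewrite mulr_ge0 ?sqr_ge0.
  by rewrite divr_ge0 ?sqr_ge0.
have h : - (r ^+ 2 * qz r) <= E0.
  rewrite /E0 /qz /zz /s; have := sqr_ge0 (2 * r * z1 r + r / 4 * q1 r).
  have := sqr_ge0 (2 * r * z2 r + r / 4 * q2 r); nra.
have h2 : - (2 * d%:R * qz r) <= E0 / 2.
  have [q0|/ltW q0] := leP 0 (qz r).
    by apply: (@le_trans _ _ 0); [rewrite oppr_le0 !mulr_ge0//|rewrite divr_ge0].
  by nra.
by have := G_ge0 (s_ge0 r); rewrite /M -/E0; lra.
Qed.

Let large_bound (r : R) : 2 * d%:R <= r ->
  M r <= M (2 * d%:R) * expR (m2 * (ln r - ln (2 * d%:R)) + C1).
Proof.
move=> rd; have [_ _ dq dz1 dz2] := sol.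
have D1 := d1; have r0_gt0 : 0 < 2 * d%:R :> R by lra.
have dM (x : R) : 0 < x -> is_derive x (1 : R) M
    (((2 - d%:R) * (4 * x ^+ 2 * zz x + x ^+ 2 / 16 * s x)
      - 4 * beta * x ^+ 2 * w x - 2 * d%:R ^+ 2 * qz x
      - d%:R * (g (s x) * s x)) / x).
  move=> x0; have [a1 a2] := dq x x0; have a3 := dz1 x x0; have a4 := dz2 x x0.
  have a5 : is_derive x (1 : R) (fun x => G (q1 x ^+ 2 + q2 x ^+ 2))
      (g (s x) * (4 * x * qz x)).
    by apply: (@D1_comp _ G); rewrite /s /qz; Dsolve; ring.
  rewrite /M /zz /s /w /qz in a5 *; Dsolve.
  by field; rewrite gt_eqF.
pose e x := - (m2 * ln x) + C1 * x ^-1 ^+ 2.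
have de (x : R) : 0 < x -> is_derive x (1 : R) e (- (m2 * x^-1) - 2 * C1 * x^-1 ^+ 3).
  move=> x0; have a1 := is_derive1_ln x0.
  have a2 : is_derive x (1 : R) (fun x => x^-1) (- x ^- 2).
    by have := @is_deriveV R id x 1 1 (lt0r_neq0 x0) (D1_id x); rewrite /= scaler1.
  rewrite /e; Dsolve; field; rewrite gt_eqF//.
pose P x := M x * expR (e x).
have dP (x : R) : 0 < x -> is_derive x (1 : R) P
    ((((2 - d%:R) * (4 * x ^+ 2 * zz x + x ^+ 2 / 16 * s x)
      - 4 * beta * x ^+ 2 * w x - 2 * d%:R ^+ 2 * qz x
      - d%:R * (g (s x) * s x)) / x + (- (m2 * x^-1) - 2 * C1 * x^-1 ^+ 3) * M x)
      * expR (e x)).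
  move=> x0; have a1 := dM x x0; have a2 := D1_expR (de x x0).
  by rewrite /P; Dsolve; ring.
have : P r <= P (2 * d%:R).
  apply: (le_of_derive_le0 rd
    (fun x (xr : 2 * d%:R <= x <= r) =>
      D1_continuous (dP x (lt_le_trans r0_gt0 (proj1 (andP xr)))))
    (fun x (xr : 2 * d%:R < x < r) => dP x (lt_trans r0_gt0 (proj1 (andP xr))))).
  move=> x /andP[/ltW xd _]; have x0 := lt_le_trans r0_gt0 xd.
  have [EM M0] := E0_le xd; set E0 := 4 * x ^+ 2 * zz x + x ^+ 2 / 16 * s x in EM *.
  rewrite pmulr_lle0 ?expR_gt0//.
  have h1 : - (x ^+ 2 * w x) <= E0.
    rewrite /E0 /w /zz /s; have := sqr_ge0 (2 * x * z2 x + x / 4 * q1 x).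
    have := sqr_ge0 (2 * x * z1 x - x / 4 * q2 x); nra.
  have h2 : `|x ^+ 2 * qz x| <= E0.
    rewrite ler_norml /E0 /qz /zz /s.
    have := sqr_ge0 (2 * x * z1 x + x / 4 * q1 x).
    have := sqr_ge0 (2 * x * z2 x + x / 4 * q2 x).
    have := sqr_ge0 (2 * x * z1 x - x / 4 * q1 x).
    have := sqr_ge0 (2 * x * z2 x - x / 4 * q2 x); nra.
  have h3 : - (m2 * G (s x)) <= d%:R * (g (s x) * s x).
    have a := G_ge0 (s_ge0 x); have b := G_le (s_ge0 x).
    have : - (m2 * G (s x)) <= d%:R * G (s x).
      have k : - m2 <= d%:R by rewrite /m2; have := beta_gt0; lra.
      by have := ler_wpM2r a k; rewrite mulNr.
    have : d%:R * G (s x) <= d%:R * (g (s x) * s x).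
      by rewrite ler_wpM2l// mulrC.
    lra.
  have h4 : - ((2 * m2 * d%:R + 2 * d%:R ^+ 2) * qz x) <= 2 * C1 * x^-1 ^+ 2 * M x.
    apply: (le_trans (ler_norm _)); rewrite normrN normrM -/C1.
    rewrite (_ : 2 * C1 * _ * _ = C1 * (x^-1 ^+ 2 * (2 * M x))); last by ring.
    apply: ler_wpM2l; first exact: normr_ge0.
    have -> : qz x = x^-1 ^+ 2 * (x ^+ 2 * qz x) by field; rewrite gt_eqF.
    rewrite normrM ger0_norm ?sqr_ge0// ler_wpM2l ?sqr_ge0//.
    exact: le_trans h2 EM.
  have -> : (((2 - d%:R) * E0 - 4 * beta * x ^+ 2 * w x - 2 * d%:R ^+ 2 * qz x
      - d%:R * (g (s x) * s x)) / x + (- (m2 * x^-1) - 2 * C1 * x^-1 ^+ 3) * M x) =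
    x^-1 * ((2 - d%:R) * E0 + 4 * beta * (- (x ^+ 2 * w x)) - 2 * d%:R ^+ 2 * qz x
      - d%:R * (g (s x) * s x) - m2 * M x - 2 * C1 * x^-1 ^+ 2 * M x).
    by field; rewrite gt_eqF.
  rewrite pmulr_rle0 ?invr_gt0//.
  have h5 : 4 * beta * (- (x ^+ 2 * w x)) <= 4 * beta * E0.
    by rewrite ler_pM2l// mulr_gt0.
  have h6 : m2 * M x = m2 * E0 + m2 * G (s x) + 2 * m2 * d%:R * qz x.
    by rewrite /M -/E0; ring.
  have h7 : m2 * E0 = (2 - d%:R + 4 * beta) * E0 by [].
  move: h3 h4 h5 h6 h7; lra.
rewrite /P => h.
have {}h : M r <= M (2 * d%:R) * expR (e (2 * d%:R) - e r).
  rewrite -(ler_pM2r (expR_gt0 (e r))) -mulrA -expRD subrK//.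
apply: (le_trans h); rewrite ler_wpM2l ?ler_expR//; first by case: (E0_le (lexx _)).
have C10 : 0 <= C1 by exact: normr_ge0.
have k1 : 0 <= C1 * r^-1 ^+ 2 by rewrite mulr_ge0// sqr_ge0.
have k2 : C1 * (2 * d%:R)^-1 ^+ 2 <= C1.
  have i0 : 0 <= (2 * d%:R : R)^-1 by rewrite invr_ge0 ltW.
  have i1 : (2 * d%:R : R)^-1 <= 1 by rewrite invf_le1//; lra.
  by rewrite ler_piMr// exprn_ile1.
rewrite /e; lra.
Qed.

Let kappa := d%:R / 2 - 2 * beta.

Definition decay_constant :=
  2 * expR (c * (2 * d%:R)) * expR (kappa * ln (1 + (2 * d%:R) ^+ 2)) +
  32 * (1 + 2 * d%:R) * (2 * expR (c * (2 * d%:R))) *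
  expR (C1 - m2 * ln (2 * d%:R) + kappa * ln 2).

Lemma radial_solution_decay (r : R) : 0 < d%:R / 2 - 2 * beta -> 0 <= r ->
  q1 r ^+ 2 + q2 r ^+ 2 <=
  decay_constant * expR (- ((d%:R / 2 - 2 * beta) * ln (1 + r ^+ 2))).
Proof.
rewrite -/kappa -/(s r) => k0 r_ge0; rewrite /decay_constant mulrDl.
set B0 := 2 * expR (c * (2 * d%:R)).
have B0_gt0 : 0 < B0 by rewrite mulr_gt0// expR_gt0.
have D1 := d1; have r0_gt0 : 0 < 2 * d%:R :> R by lra.
have [rd|/ltW rd] := leP r (2 * d%:R).
  have hN : N r <= B0 by apply: small_bound; rewrite r_ge0.
  have hs : s r <= B0.
    apply: le_trans hN; have := G_ge0 (s_ge0 r).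
    have : 0 <= r ^+ 2 * zz r by rewrite mulr_ge0 ?sqr_ge0.
    have : 0 <= r ^+ 2 * s r by rewrite mulr_ge0 ?sqr_ge0.
    rewrite /N; lra.
  apply: (le_trans hs); apply: (@le_trans _ _ (B0 *
      expR (kappa * ln (1 + (2 * d%:R) ^+ 2)) * expR (- (kappa * ln (1 + r ^+ 2))))).
    rewrite -mulrA; apply: ler_peMr; first exact: ltW.
    rewrite -expRD -[leLHS]expR0 ler_expR -mulrBr.
    rewrite mulr_ge0 ?(ltW k0)// subr_ge0 ler_ln ?posrE ?ltr_wpDr ?sqr_ge0//.
    by rewrite lerD2l ler_sqr ?nnegrE// ltW.
  rewrite lerDl !mulr_ge0// ?expR_ge0// ?addr_ge0// ?mulr_ge0// ?ltW//.
have r_gt0 := lt_le_trans r0_gt0 rd.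
have [EM M0] := E0_le rd.
have hM := large_bound rd.
have hM0 : M (2 * d%:R) <= (1 + 2 * d%:R) * B0.
  have hN : N (2 * d%:R) <= B0 by apply: small_bound; rewrite lexx ltW.
  have S0 := s_ge0 (2 * d%:R); have Z0 := zz_ge0 (2 * d%:R).
  have G0 := G_ge0 S0.
  have qzle : 2 * qz (2 * d%:R) <= s (2 * d%:R) + zz (2 * d%:R).
    rewrite /qz /s /zz; have := sqr_ge0 (q1 (2 * d%:R) - z1 (2 * d%:R)).
    have := sqr_ge0 (q2 (2 * d%:R) - z2 (2 * d%:R)); lra.
  have r21 : 1 <= (2 * d%:R) ^+ 2 :> R by rewrite exprn_ege1//; lra.
  have Zle : zz (2 * d%:R) <= (2 * d%:R) ^+ 2 * zz (2 * d%:R) by rewrite ler_peMl.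
  have Sle : 0 <= (2 * d%:R) ^+ 2 / 16 * s (2 * d%:R).
    by rewrite mulr_ge0// divr_ge0// sqr_ge0.
  have SZ : s (2 * d%:R) + zz (2 * d%:R) <= 2 * B0.
    by move: hN; rewrite /N; lra.
  have : d%:R * (2 * qz (2 * d%:R)) <= d%:R * (2 * B0).
    by rewrite ler_wpM2l ?ler0n// (le_trans qzle).
  move: hN; rewrite /N /M; lra.
have r2_gt0 : 0 < r ^+ 2 by rewrite exprn_gt0.
have hs : s r <= 32 * (M r * expR (- (2 * ln r))).
  have -> : expR (- (2 * ln r)) = (r ^+ 2)^-1.
    by rewrite expRN expRM_natl lnK ?posrE.
  rewrite mulrA ler_pdivlMr//.
  have : 0 <= r ^+ 2 * zz r by rewrite mulr_ge0 ?sqr_ge0.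
  by move: EM; lra.
apply: (le_trans hs); apply: ler_wpDl.
  by rewrite !mulr_ge0 ?expR_ge0// ltW.
rewrite -!mulrA ler_pM2l// mulrA.
apply: (@le_trans _ _ ((1 + 2 * d%:R) * B0 * expR (m2 * (ln r - ln (2 * d%:R)) + C1)
    * expR (- (2 * ln r)))).
  rewrite ler_wpM2r ?expR_ge0//; apply: (le_trans hM).
  by rewrite ler_wpM2r ?expR_ge0.
rewrite -!mulrA -!expRD; rewrite ler_pM2l ?ltr_wpDr ?mulr_ge0 ?ler0n//.
rewrite ler_pM2l// ler_expR.
have : ln (1 + r ^+ 2) <= ln 2 + 2 * ln r.
  have -> : 2 * ln r = ln (r ^+ 2) by rewrite lnXn// mulr_natl.
  rewrite -lnM ?posrE// ler_ln ?posrE ?ltr_wpDr ?sqr_ge0// ?mulr_gt0//.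
  have : 1 <= r ^+ 2 by rewrite exprn_ege1//; lra.
  lra.
rewrite -subr_ge0 => hl.
have : 0 <= kappa * (ln 2 + 2 * ln r - ln (1 + r ^+ 2)) by rewrite mulr_ge0// ltW.
rewrite /m2 /kappa; lra.
Qed.

End energy.
End profile_estimates.

(** * Existence of the profile *)

Section truncated_nonlinearity.
Context {R : realType}.
Variables (sigma k : R).
Hypotheses (sigma_gt0 : 0 < sigma) (k_ge1 : 1 <= k).

Definition trunc_pow (s : R) : R := Num.min (Num.sqrt s) k `^ (2 * sigma).

Let k_gt0 : 0 < k. Proof. exact: lt_le_trans k_ge1. Qed.
Let sigma2_gt0 : 0 < 2 * sigma. Proof. by rewrite mulr_gt0. Qed.

Let min_ge0 (s : R) : 0 <= Num.min (Num.sqrt s) k.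
Proof. by rewrite le_min sqrtr_ge0 ltW. Qed.

Lemma continuous_max0_powR (p : R) : 0 < p ->
  continuous (fun x : R => Num.max x 0 `^ p).
Proof.
move=> p0 x; have [x_lt0|x_gt0|->] := ltgtP x 0.
- have E : \forall z \near x, (fun=> 0 : R) z = Num.max z 0 `^ p.
    near=> z; have z0 : z < 0 by near: z; exact: lt_nbhsl.
    by rewrite max_r ?(ltW z0)// powR0 ?gt_eqF.
  rewrite /continuous_at max_r ?(ltW x_lt0)// powR0 ?gt_eqF//.
  by apply: cvg_trans (near_eq_cvg E) _; exact: cvg_cst.
- have E : \forall z \near x, z `^ p = Num.max z 0 `^ p.
    near=> z; have z0 : 0 < z by near: z; exact: lt_nbhsr.
    by rewrite max_l ?(ltW z0).
  rewrite /continuous_at max_l ?(ltW x_gt0)//.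
  apply: cvg_trans (near_eq_cvg E) _.
  exact: D1_continuous (is_derive1_powR p x_gt0).
- rewrite /continuous_at maxxx powR0 ?gt_eqF//.
  apply/cvgrPdist_le => e e0.
  have d0 : 0 < e `^ p^-1 by rewrite powR_gt0.
  exists (e `^ p^-1); first exact: d0.
  move=> z /=; rewrite sub0r normrN => /ltW zd.
  rewrite sub0r normrN ger0_norm ?powR_ge0//.
  apply: (@le_trans _ _ ((e `^ p^-1) `^ p)).
    apply: ge0_ler_powR; rewrite ?nnegrE ?(ltW p0) ?(ltW d0) ?le_max ?lexx ?orbT//.
    by rewrite ge_max (ltW d0) andbT (le_trans (ler_norm z)).
  by rewrite -powRrM mulVf ?gt_eqF// powRr1// ltW.
Unshelve. all: by end_near. Qed.

Lemma trunc_pow_continuous : continuous trunc_pow.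
Proof.
have -> : trunc_pow = (fun x : R => Num.max x 0 `^ (2 * sigma)) \o
    (fun s => Num.min (Num.sqrt s) k).
  by apply/funext => s; rewrite /trunc_pow /= max_l.
move=> s; apply: continuous_comp; last exact: continuous_max0_powR.
apply: (@continuous_min R _ (@Num.sqrt R) (fun=> k)); first exact: sqrt_continuous.
exact: cst_continuous.
Qed.

Lemma trunc_pow_ge0 s : 0 <= trunc_pow s. Proof. exact: powR_ge0. Qed.

Lemma trunc_pow_le s t : s <= t -> trunc_pow s <= trunc_pow t.
Proof.
move=> st; apply: ge0_ler_powR; rewrite ?nnegrE ?(ltW sigma2_gt0)//.
by rewrite le_min !ge_min ler_wsqrtr// lexx orbT.
Qed.

Lemma trunc_pow_max s : trunc_pow s <= k `^ (2 * sigma).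
Proof.
by apply: ge0_ler_powR; rewrite ?nnegrE ?(ltW sigma2_gt0) ?(ltW k_gt0)// ge_min lexx orbT.
Qed.

Lemma trunc_powE s : 0 <= s <= k ^+ 2 -> trunc_pow s = s `^ sigma.
Proof.
move=> /andP[s0 sk]; rewrite /trunc_pow min_l; last first.
  by rewrite -(ger0_norm (ltW k_gt0)) -sqrtr_sqr ler_wsqrtr.
by rewrite powRrM -[2]/(2%:R) powR_mulrn ?sqrtr_ge0// sqr_sqrtr.
Qed.

Lemma norm_le_sqrt (a b : R) : `|a| <= Num.sqrt (a ^+ 2 + b ^+ 2).
Proof. by rewrite -sqrtr_sqr ler_wsqrtr// lerDl sqr_ge0. Qed.

Let sqrt_sub (a b a' b' : R) : Num.sqrt (a' ^+ 2 + b' ^+ 2) <=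
  Num.sqrt (a ^+ 2 + b ^+ 2) + (`|a - a'| + `|b - b'|).
Proof.
set r := Num.sqrt (a ^+ 2 + b ^+ 2).
have r0 : 0 <= r by exact: sqrtr_ge0.
have ar : `|a| <= r by exact: norm_le_sqrt.
have br : `|b| <= r by rewrite /r addrC; exact: norm_le_sqrt.
have rr : r ^+ 2 = a ^+ 2 + b ^+ 2 by rewrite sqr_sqrtr// addr_ge0 ?sqr_ge0.
set x := `|a - a'|; set y := `|b - b'|.
have x0 : 0 <= x by exact: normr_ge0.
have y0 : 0 <= y by exact: normr_ge0.
rewrite -[leRHS]ger0_norm ?addr_ge0// -sqrtr_sqr ler_wsqrtr//.
have h1 : - (a * (a - a')) <= r * x.
  by apply: (le_trans (ler_norm _)); rewrite normrN normrM ler_pM.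
have h2 : - (b * (b - b')) <= r * y.
  by apply: (le_trans (ler_norm _)); rewrite normrN normrM ler_pM.
have h3 : (a - a') ^+ 2 = x ^+ 2 by rewrite /x real_normK ?num_real.
have h4 : (b - b') ^+ 2 = y ^+ 2 by rewrite /y real_normK ?num_real.
have h5 : 0 <= x * y by rewrite mulr_ge0.
nra.
Qed.

Lemma trunc_pow_lipschitz (a b a' b' : R) :
  `|trunc_pow (a ^+ 2 + b ^+ 2) * a - trunc_pow (a' ^+ 2 + b' ^+ 2) * a'| <=
  (2 * sigma + 1) * k `^ (2 * sigma) * (`|a - a'| + `|b - b'|).
Proof.
wlog ss : a b a' b' / a ^+ 2 + b ^+ 2 <= a' ^+ 2 + b' ^+ 2.
  move=> H; have [/H//|/ltW/H] := leP (a ^+ 2 + b ^+ 2) (a' ^+ 2 + b' ^+ 2).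
  by rewrite (distrC a') (distrC b') (distrC (_ * a')).
set del := `|a - a'| + `|b - b'|.
have del0 : 0 <= del by rewrite addr_ge0.
set S := a ^+ 2 + b ^+ 2 in ss *; set S' := a' ^+ 2 + b' ^+ 2 in ss *.
set KK := k `^ (2 * sigma).
have KK0 : 0 <= KK by exact: powR_ge0.
rewrite (_ : _ - _ = trunc_pow S' * (a - a') - (trunc_pow S' - trunc_pow S) * a);
  last by ring.
apply: (le_trans (ler_normB _ _)).
have T0 : 0 <= trunc_pow S' - trunc_pow S by rewrite subr_ge0 trunc_pow_le.
rewrite !normrM (ger0_norm (trunc_pow_ge0 _)) (ger0_norm T0).
have h1 : trunc_pow S' * `|a - a'| <= KK * del.
  by apply: ler_pM; rewrite ?trunc_pow_ge0 ?trunc_pow_max// lerDl.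
suff h2 : (trunc_pow S' - trunc_pow S) * `|a| <= 2 * sigma * KK * del by lra.
have S0 : 0 <= S by rewrite addr_ge0 ?sqr_ge0.
set r := Num.sqrt S; set r' := Num.sqrt S'.
have ar : `|a| <= r by exact: norm_le_sqrt.
have r0 : 0 <= r by exact: sqrtr_ge0.
have rr' : r <= r' by rewrite ler_wsqrtr.
have r'r : r' <= r + del by exact: sqrt_sub.
apply: (@le_trans _ _ ((trunc_pow S' - trunc_pow S) * r)).
  by rewrite ler_wpM2l// subr_ge0 trunc_pow_le.
have [kr|rk] := leP k r.
  rewrite /trunc_pow -/r -/r' !min_r ?(le_trans kr)// subrr mul0r.
  by rewrite !mulr_ge0// ltW.
have [r_le0|r_gt0] := leP r 0.
  have -> : r = 0 by apply/eqP; rewrite eq_le r_le0.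
  by rewrite mulr0 !mulr_ge0// ltW.
rewrite /trunc_pow -/r -/r' (min_l (ltW rk)); set x := Num.min r' k.
have xk : x <= k by rewrite /x ge_min lexx orbT.
have xr' : x <= r' by rewrite /x ge_min lexx.
have [rx|xr] := ltP r x; last first.
  have : r <= x by rewrite /x le_min rr' ltW.
  move=> rx; have -> : x = r by apply/eqP; rewrite eq_le xr.
  by rewrite subrr mul0r !mulr_ge0// ltW.
have D (z : R) : 0 < z -> is_derive z (1 : R) (fun z => z `^ (2 * sigma))
    (2 * sigma * z `^ (2 * sigma - 1)) by exact: is_derive1_powR.
have [||c] := @MVT R (fun z => z `^ (2 * sigma)) (fun z => 2 * sigma * z `^ (2 * sigma - 1)) r x rx.
- by move=> z; rewrite in_itv/= => /andP[rz _]; apply: D; exact: lt_trans rz.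
- apply: continuous_in_subspaceT => z; rewrite inE/= in_itv/= => /andP[rz _].
  by apply: D1_continuous (D z _); exact: lt_le_trans rz.
rewrite in_itv/= => /andP[rc cx] ->.
have c0 : 0 < c by exact: lt_trans rc.
rewrite -!mulrA ler_pM2l// ler_pM2l//.
have -> : c `^ (2 * sigma - 1) * ((x - r) * r) = (c `^ (2 * sigma - 1) * r) * (x - r).
  by ring.
apply: ler_pM; rewrite ?mulr_ge0 ?powR_ge0 ?subr_ge0 ?(ltW rx)//; last by lra.
apply: (@le_trans _ _ (c * c `^ (2 * sigma - 1))).
  by rewrite mulrC ler_wpM2r ?powR_ge0// ltW.
rewrite mulr_powRB1 ?(ltW c0)//; apply: ge0_ler_powR; rewrite ?nnegrE ?(ltW c0)//.
- exact: ltW.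
- exact: ltW.
by rewrite ltW// (lt_le_trans cx).
Qed.

End truncated_nonlinearity.

Section profile.
Context {R : realType}.
Variables (d : nat) (sigma : R).
Hypotheses (d_gt0 : (0 < d)%N) (sigma_gt0 : 0 < sigma)
  (sd1 : 1 < sigma * d%:R) (sd2 : sigma * d%:R < 2).

Let beta := (2 * sigma)^-1 - d%:R / 4.
Let kappa := d%:R - sigma^-1.

Let beta_gt0 : 0 < beta.
Proof.
have -> : beta = (2 - sigma * d%:R) / (4 * sigma) by rewrite /beta; field; rewrite gt_eqF.
by rewrite divr_gt0 ?mulr_gt0// subr_gt0.
Qed.

Let kappaE : d%:R / 2 - 2 * beta = kappa.
Proof. by rewrite /beta /kappa; field; rewrite gt_eqF. Qed.

Let kappa_gt0 : 0 < kappa.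
Proof.
have -> : kappa = (sigma * d%:R - 1) / sigma by rewrite /kappa; field; rewrite gt_eqF.
by rewrite divr_gt0// subr_gt0.
Qed.

Definition nls_field1 (gam : R -> R) (y a b : R) : R :=
  (y / 16 + gam (a ^+ 2 + b ^+ 2)) * a - beta * b.
Definition nls_field2 (gam : R -> R) (y a b : R) : R :=
  (y / 16 + gam (a ^+ 2 + b ^+ 2)) * b + beta * a.

Let trunc_profile (k : R) : 1 <= k -> exists a b : R -> R,
  [/\ a 0 = 1, b 0 = 0,
    forall y, is_derive y (1 : R) a (- (2^-1 *
      avg d.-1 (fun x : R => nls_field1 (trunc_pow sigma k) x (a x) (b x)) y)) &
    forall y, is_derive y (1 : R) b (- (2^-1 *
      avg d.-1 (fun x : R => nls_field2 (trunc_pow sigma k) x (a x) (b x)) y))].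
Proof.
move=> k1.
pose L := (2 * sigma + 1) * k `^ (2 * sigma).
have L0 : 0 <= L by rewrite mulr_ge0 ?powR_ge0// addr_ge0// mulr_ge0// ltW.
have cf (a b : R -> R) : continuous a -> continuous b ->
    continuous (fun y : R => y / 16 + trunc_pow sigma k (a y ^+ 2 + b y ^+ 2)).
  move=> ca cb y.
  change {for y, continuous (fun y : R => y / 16 + trunc_pow sigma k (a y ^+ 2 + b y ^+ 2))}.
  apply: continuousD.
    by apply: continuousM; [exact: cvg_id|exact: cst_continuous].
  apply: (@continuous_comp _ _ _ (fun y : R => a y ^+ 2 + b y ^+ 2) (trunc_pow sigma k)).
    apply: continuousD.
      apply: (@continuous_comp _ _ _ a (fun x : R => x ^+ 2)); first exact: ca.
      exact: exprn_continuous.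
    apply: (@continuous_comp _ _ _ b (fun x : R => x ^+ 2)); first exact: cb.
    exact: exprn_continuous.
  exact: trunc_pow_continuous.
apply: (@picard_existence R (beta + L) 16^-1).
- by rewrite addr_ge0// ltW.
- by rewrite invr_ge0.
- split.
  + move=> a b ca cb y.
    change {for y, continuous (fun y : R => nls_field1 (trunc_pow sigma k) y (a y) (b y))}.
    apply: continuousB; first by apply: continuousM; [exact: cf|exact: ca].
    by apply: continuousM; [exact: cst_continuous|exact: cb].
  + by move=> y; rewrite /nls_field1 !mulr0 subrr.
  + move=> y a b a' b'; rewrite /nls_field1.
    have lip := trunc_pow_lipschitz sigma_gt0 k1 a b a' b'.
    set T := trunc_pow _ _ _ in lip *; set T' := trunc_pow _ _ (a' ^+ 2 + _) in lip *.
    rewrite (_ : _ - _ = 16^-1 * y * (a - a') + (T * a - T' * a') + beta * (b' - b));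
      last by ring.
    apply: (le_trans (ler_normD _ _)).
    have h1 : `|16^-1 * y * (a - a') + (T * a - T' * a')| <= 16^-1 * `|y| * `|a - a'|
        + L * (`|a - a'| + `|b - b'|).
      apply: (le_trans (ler_normD _ _)); apply: lerD => //.
      by rewrite !normrM [`|16^-1|]ger0_norm// invr_ge0.
    have h2 : `|beta * (b' - b)| = beta * `|b - b'|.
      by rewrite normrM (distrC b') (ger0_norm (ltW beta_gt0)).
    have h3 : 0 <= beta * `|a - a'| by rewrite mulr_ge0// ltW.
    have h4 : 0 <= `|y| * `|b - b'| by rewrite mulr_ge0.
    lra.
- split.
  + move=> a b ca cb y.
    change {for y, continuous (fun y : R => nls_field2 (trunc_pow sigma k) y (a y) (b y))}.
    apply: continuousD; first by apply: continuousM; [exact: cf|exact: cb].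
    by apply: continuousM; [exact: cst_continuous|exact: ca].
  + by move=> y; rewrite /nls_field2 !mulr0 addr0.
  + move=> y a b a' b'; rewrite /nls_field2.
    have lip := trunc_pow_lipschitz sigma_gt0 k1 b a b' a'.
    rewrite (addrC (b ^+ 2)) (addrC (b' ^+ 2)) in lip.
    set T := trunc_pow _ _ _ in lip *; set T' := trunc_pow _ _ (a' ^+ 2 + _) in lip *.
    rewrite (_ : _ - _ = 16^-1 * y * (b - b') + (T * b - T' * b') + beta * (a - a'));
      last by ring.
    apply: (le_trans (ler_normD _ _)).
    have h1 : `|16^-1 * y * (b - b') + (T * b - T' * b')| <= 16^-1 * `|y| * `|b - b'|
        + L * (`|b - b'| + `|a - a'|).
      apply: (le_trans (ler_normD _ _)); apply: lerD => //.
      by rewrite !normrM [`|16^-1|]ger0_norm// invr_ge0.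
    have h2 : `|beta * (a - a')| = beta * `|a - a'|.
      by rewrite normrM (ger0_norm (ltW beta_gt0)).
    have h3 : 0 <= beta * `|b - b'| by rewrite mulr_ge0// ltW.
    have h4 : 0 <= `|y| * `|a - a'| by rewrite mulr_ge0.
    lra.
Qed.

Lemma avg_radial_derive (h f' : R -> R) : continuous h ->
  (forall y, f' y = - (2^-1 * avg d.-1 h y)) ->
  forall r : R, 0 < r -> is_derive r (1 : R) (fun r => f' (r ^+ 2))
    (- (d%:R * f' (r ^+ 2) + 2^-1 * h (r ^+ 2)) / r).
Proof.
move=> ch f'E r r0.
have D1 := radial_avg_derive d.-1 ch r.
have rN0 : r != 0 by rewrite gt_eqF.
have D2 : is_derive r (1 : R) (fun x : R => x^-1) (- r ^- 2).
  by have := @is_deriveV R id r 1 1 rN0 (D1_id r); rewrite /= scaler1.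
have D3 : is_derive r (1 : R) (fun x : R => - (2^-1 *
    ((x ^+ d.-1.+1 * avg d.-1 h (x ^+ 2)) * x^-1 ^+ d)))
    (- (d%:R * f' (r ^+ 2) + 2^-1 * h (r ^+ 2)) / r).
  Dsolve; rewrite f'E.
  rewrite -(prednK d_gt0) /= !exprS exprVn.
  have rn : r ^+ d.-1 != 0 by rewrite expf_neq0.
  by field; rewrite rN0.
apply: near_eq_is_derive D3.
near=> z; have z0 : 0 < z by near: z; exact: lt_nbhsr.
rewrite f'E prednK// mulrAC -exprMn divff ?gt_eqF// expr1n mul1r//.
Unshelve. all: by end_near. Qed.

Lemma exists_profile : exists a b : R -> R, exists e B : R,
  [/\ 0 < e /\ 0 < B, a 0 = 1 /\ b 0 = 0,
    forall y, - e < y ->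
      is_derive y (1 : R) a (- (2^-1 *
        avg d.-1 (fun x : R => nls_field1 (fun s : R => s `^ sigma) x (a x) (b x)) y)) /\
      is_derive y (1 : R) b (- (2^-1 *
        avg d.-1 (fun x : R => nls_field2 (fun s : R => s `^ sigma) x (a x) (b x)) y)),
    forall y, - e < y -> 0 < a y ^+ 2 + b y ^+ 2 &
    forall y, 0 <= y -> a y ^+ 2 + b y ^+ 2 <= B * expR (- (kappa * ln (1 + y)))].
Proof.
pose B := decay_constant d beta.
have B_gt0 : 0 < B.
  by rewrite /B /decay_constant addr_gt0 ?mulr_gt0 ?expR_gt0// ltr_wpDr// mulr_ge0.
pose k := Num.sqrt B + 2.
have k1 : 1 <= k by rewrite /k -lerBlDr; apply: le_trans (sqrtr_ge0 _); lra.
have k0 : 0 < k by exact: lt_le_trans k1.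
have kB : B < k ^+ 2.
  have := sqr_sqrtr (ltW B_gt0); have := sqrtr_ge0 B; rewrite /k; nra.
have k21 : 1 < k ^+ 2 by rewrite exprn_egt1// /k -ltrBlDr; apply: lt_le_trans (sqrtr_ge0 _); lra.
have [a [b [a0 b0 da db]]] := trunc_profile k1.
set g := trunc_pow sigma k in da db.
have ca : continuous a by move=> y; exact: D1_continuous (da y).
have cb : continuous b by move=> y; exact: D1_continuous (db y).
have cs : continuous (fun y : R => a y ^+ 2 + b y ^+ 2).
  move=> y; change {for y, continuous (fun y : R => a y ^+ 2 + b y ^+ 2)}.
  apply: continuousD.
    apply: (@continuous_comp _ _ _ a (fun x : R => x ^+ 2)); first exact: ca.
    exact: exprn_continuous.
  apply: (@continuous_comp _ _ _ b (fun x : R => x ^+ 2)); first exact: cb.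
  exact: exprn_continuous.
have cg : continuous (fun y : R => y / 16 + g (a y ^+ 2 + b y ^+ 2)).
  move=> y; change {for y, continuous (fun y : R => y / 16 + g (a y ^+ 2 + b y ^+ 2))}.
  apply: continuousD.
    by apply: continuousM; [exact: cvg_id|exact: cst_continuous].
  apply: (@continuous_comp _ _ _ (fun y : R => a y ^+ 2 + b y ^+ 2) g); first exact: cs.
  exact: trunc_pow_continuous.
have cf1 : continuous (fun x : R => nls_field1 g x (a x) (b x)).
  move=> y; change {for y, continuous (fun x : R => nls_field1 g x (a x) (b x))}.
  apply: continuousB; first by apply: continuousM; [exact: cg|exact: ca].
  by apply: continuousM; [exact: cst_continuous|exact: cb].
have cf2 : continuous (fun x : R => nls_field2 g x (a x) (b x)).
  move=> y; change {for y, continuous (fun x : R => nls_field2 g x (a x) (b x))}.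
  apply: continuousD; first by apply: continuousM; [exact: cg|exact: cb].
  by apply: continuousM; [exact: cst_continuous|exact: ca].
pose a' y := - (2^-1 * avg d.-1 (fun x : R => nls_field1 g x (a x) (b x)) y).
pose b' y := - (2^-1 * avg d.-1 (fun x : R => nls_field2 g x (a x) (b x)) y).
have ca' : continuous a'.
  move=> y; change {for y, continuous a'}.
  apply: continuousN; apply: continuousM; first exact: cst_continuous.
  apply: (@avg_continuous R _ _ (- `|y| - 1)); first by have := normr_ge0 y; lra.
    by move=> z _; exact: cf1.
  by have := norm_itv y; lra.
have cb' : continuous b'.
  move=> y; change {for y, continuous b'}.
  apply: continuousN; apply: continuousM; first exact: cst_continuous.
  apply: (@avg_continuous R _ _ (- `|y| - 1)); first by have := normr_ge0 y; lra.
    by move=> z _; exact: cf2.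
  by have := norm_itv y; lra.
have csq (f : R -> R) : continuous f -> continuous (fun r : R => f (r ^+ 2)).
  move=> cf r; apply: (@continuous_comp _ _ _ (fun r : R => r ^+ 2) f); last exact: cf.
  exact: exprn_continuous.
have Dsq (f : R -> R) (f' r : R) : is_derive (r ^+ 2) (1 : R) f f' ->
    is_derive r (1 : R) (fun r => f (r ^+ 2)) (2 * r * f').
  move=> df; have D1 : is_derive r (1 : R) (fun r : R => r ^+ 2) (2 * r) by Dsolve; ring.
  by apply: D1_eq (@D1_comp R f (fun r : R => r ^+ 2) r _ _ df D1) _; rewrite mulrC.
have sol : radial_solution d beta g (fun r => a (r ^+ 2)) (fun r => b (r ^+ 2))
    (fun r => a' (r ^+ 2)) (fun r => b' (r ^+ 2)).
  split.
  - by rewrite expr0n.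
  - by split; exact: csq.
  - by move=> r _; split; apply: Dsq.
  - by move=> r r0; exact: (@avg_radial_derive _ a' cf1 (fun=> erefl) r r0).
  - by move=> r r0; exact: (@avg_radial_derive _ b' cf2 (fun=> erefl) r r0).
have [G [G0 dG]] := exists_primitive (trunc_pow_continuous sigma_gt0 k1).
rewrite -/g in dG.
have cG (x : R) : {for x, continuous G} by exact: D1_continuous (dG x).
have G_ge0 s : 0 <= s -> 0 <= G s.
  move=> s0; suff : - G s <= - G 0 by rewrite G0 oppr0 oppr_le0.
  apply: (@le_of_derive_le0 R (fun x : R => - G x) (fun x : R => - g x) 0 s s0
    (fun x _ => continuousN (cG x)) (fun x _ => D1_opp (dG x))).
  by move=> x _; rewrite oppr_le0 trunc_pow_ge0.
have G_le s : 0 <= s -> G s <= s * g s.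
  move=> s0; rewrite -subr_le0.
  have D (x : R) : is_derive x (1 : R) (fun x : R => G x - x * g s) (g x - g s).
    by have := dG x => h; Dsolve; ring.
  have := @le_of_derive_le0 R (fun x : R => G x - x * g s) _ 0 s s0
    (fun x _ => D1_continuous (D x)) (fun x _ => D x).
  rewrite G0 mul0r subr0; apply=> x /andP[_ /ltW xs].
  by rewrite subr_le0 trunc_pow_le.
have G1 : G 1 <= 1.
  apply: (le_trans (G_le _ ler01)).
  by rewrite mul1r /g trunc_powE ?powR1// ler01 ltW.
have sq y : 0 <= y -> Num.sqrt y ^+ 2 = y by exact: sqr_sqrtr.
have decay y : 0 <= y -> a y ^+ 2 + b y ^+ 2 <= B * expR (- (kappa * ln (1 + y))).
  move=> y0; have := @radial_solution_decay R d beta d_gt0 beta_gt0 g G _ _ _ _ sol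
    dG G_ge0 G_le G1 (Num.sqrt y); rewrite kappaE sq//.
  by apply; rewrite ?sqrtr_ge0.
have pos y : 0 <= y -> 0 < a y ^+ 2 + b y ^+ 2.
  by move=> y0; have := radial_solution_neq0 d_gt0 beta_gt0 sol (sqrtr_ge0 y); rewrite sq.
have ub y : 0 <= y -> a y ^+ 2 + b y ^+ 2 < k ^+ 2.
  move=> y0; apply: le_lt_trans kB; apply: (le_trans (decay y y0)).
  rewrite ler_piMr ?(ltW B_gt0)// -[leRHS]expR0 ler_expR oppr_le0.
  by rewrite mulr_ge0 ?(ltW kappa_gt0)// ln_ge0// lerDl.
have [e e0 he] : exists2 e, 0 < e & forall y, - e < y ->
    0 < a y ^+ 2 + b y ^+ 2 < k ^+ 2.
  have n1 : \forall y \near (0 : R), 0 < a y ^+ 2 + b y ^+ 2.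
    by apply: (cvgr_gt _ (cs 0)); exact: pos.
  have n2 : \forall y \near (0 : R), a y ^+ 2 + b y ^+ 2 < k ^+ 2.
    by apply: (cvgr_lt _ (cs 0)); exact: ub.
  have : \forall y \near (0 : R), 0 < a y ^+ 2 + b y ^+ 2 /\ a y ^+ 2 + b y ^+ 2 < k ^+ 2.
    exact: filterI n1 n2.
  move=> /nbhs_ballP[e /= e0 he].
  exists e => // y ey; have [y0|y0] := leP 0 y; first by rewrite pos// ub.
  by apply/andP; apply: he; rewrite /ball/= sub0r normrN ltr0_norm//; lra.
exists a, b, e, B; split.
- by split.
- by split.
- move=> y ey; split.
    apply: D1_eq (da y) _; apply: (congr1 (fun z => - (2^-1 * z))).
    apply: (@eq_avg R _ _ _ (- e)) => //.
      by rewrite oppr_lt0.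
    by move=> x /he /andP[/ltW x0 /ltW x1]; rewrite /nls_field1 /g trunc_powE// x0.
  apply: D1_eq (db y) _; apply: (congr1 (fun z => - (2^-1 * z))).
    apply: (@eq_avg R _ _ _ (- e)) => //.
    by rewrite oppr_lt0.
  by move=> x /he /andP[/ltW x0 /ltW x1]; rewrite /nls_field2 /g trunc_powE// x0.
- by move=> y /he /andP[].
- exact: decay.
Qed.

End profile.

(** * Smooth functions on open sets *)

Section smooth_functions.
Context {R : realType}.

Section general.
Context {V W : normedModType R}.
Implicit Types (f g : V -> W) (U : set V).

(* Unlike [iterD], the recursion strips the innermost derivative, so that the
   Leibniz and chain rules give direct inductions. *)
Fixpoint Cn U n f : Prop :=
  match n with
  | 0 => forall z, U z -> {for z, continuous f}
  | n.+1 => (forall z, U z -> differentiable f z) /\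
            forall v, Cn U n (fun z => 'D_v f z)
  end.

Lemma CnSP U n f : Cn U n.+1 f <->
  (forall z, U z -> differentiable f z) /\ forall v, Cn U n (fun z => 'D_v f z).
Proof. by []. Qed.

Lemma near_eq_differentiable f g (z : V) :
  (\forall y \near z, f y = g y) -> differentiable f z -> differentiable g z.
Proof.
move=> fg df; pose h := (fun y => g y - f y).
have -> : g = f + h by apply/funext => y; rewrite /h fctE /= addrC subrK.
apply: differentiableD => //.
have hE : h \o shift z = cst (h z) + (\0%R : {linear V -> W}) +o_ (0 : V) id.
  apply/eqaddoP => _/posnumP[eps].
  have hz : h z = 0 by rewrite /h (nbhs_singleton fg) subrr.
  have : \forall y \near (0 : V), f (y + z) = g (y + z).
    by move: fg; rewrite (near_shift 0) /= subr0.
  apply: filterS => y fgy.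
  by rewrite !fctE/= /shift/= hz /h fgy subrr addr0 subr0 normr0 mulr_ge0.
have c0 : continuous (\0%R : {linear V -> W}) by move=> ?; exact: cst_continuous.
have dh := diff_unique c0 hE.
by apply/diff_locallyP; rewrite dh.
Qed.

Lemma Cn_continuous U n f : Cn U n f -> forall z, U z -> {for z, continuous f}.
Proof.
case: n => // n /CnSP[df _] z Uz; exact/differentiable_continuous/df.
Qed.

Lemma CnW U n f : Cn U n.+1 f -> Cn U n f.
Proof.
elim: n f => [|n IH] f /CnSP[df Df]; first by move=> z /df /differentiable_continuous.
by apply/CnSP; split=> // v; exact: IH.
Qed.

Lemma CnS_derive U n f (v : V) : Cn U n.+1 f -> Cn U n (fun z => 'D_v f z).
Proof. by move=> /CnSP[_]; apply. Qed.

Lemma eq_Cn U n f g : open U -> (forall z, U z -> f z = g z) ->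
  Cn U n f -> Cn U n g.
Proof.
move=> oU; have near_eq (f1 g1 : V -> W) z : (forall z, U z -> f1 z = g1 z) -> U z ->
    \forall y \near z, f1 y = g1 y.
  by move=> e Uz; apply: filterS (open_nbhs_nbhs (conj oU Uz)) => y /e.
elim: n f g => [|n IH] f g fg.
  move=> cf z Uz; change (g @ z --> g z); rewrite -(fg z Uz).
  exact: cvg_trans (near_eq_cvg (near_eq _ _ _ fg Uz)) (cf _ Uz).
move=> /CnSP[df Df]; apply/CnSP; split.
  by move=> z Uz; exact: near_eq_differentiable (near_eq _ _ _ fg Uz) (df _ Uz).
move=> v; apply: IH (Df v) => z Uz; apply: near_eq_derive; exact: near_eq.
Qed.

Lemma Cn_smooth U f : (forall n, Cn U n f) -> smooth_on U f.
Proof.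
move=> Cf vs; elim/last_ind: vs f Cf => [|vs v IH] f Cf z Uz.
  by have /CnSP[df _] := Cf 1%N; exact: df.
have -> : Defs.iterD (rcons vs v) f = Defs.iterD vs (fun z => 'D_v f z).
  by elim: vs {IH} => //= w vs ->.
by apply: IH => // n; exact: CnS_derive (Cf n.+1).
Qed.

Lemma Cn_cst U n (c : W) : Cn U n (fun=> c).
Proof.
elim: n c => [|n IH] c; first by move=> z _; exact: cst_continuous.
apply/CnSP; split=> [z _|v]; first exact: differentiable_cst.
have -> : (fun z => 'D_v (fun=> c) z) = (fun=> 0 : W).
  by apply/funext => z; rewrite derive_cst.
exact: IH.
Qed.

Lemma Cn_linear U n (f : {linear V -> W}) : continuous f -> Cn U n f.
Proof.
move=> cf; case: n => [|n]; first by move=> z _; exact: cf.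
apply/CnSP; split=> [z _|v]; first exact: linear_differentiable.
have -> : (fun z => 'D_v f z) = (fun=> f v).
  apply/funext => z; rewrite deriveE; last exact: linear_differentiable.
  by rewrite diff_lin.
exact: Cn_cst.
Qed.

Lemma CnD U n f g : open U -> Cn U n f -> Cn U n g -> Cn U n (fun z => f z + g z).
Proof.
move=> oU; elim: n f g => [|n IH] f g.
  by move=> cf cg z Uz; apply: continuousD; [exact: cf|exact: cg].
move=> /CnSP[df Df] /CnSP[dg Dg]; apply/CnSP; split.
  by move=> z Uz; apply: differentiableD; [exact: df|exact: dg].
move=> v; apply: eq_Cn (IH _ _ (Df v) (Dg v)) => // z Uz.
by rewrite deriveD//; apply: diff_derivable; [exact: df|exact: dg].
Qed.

End general.

Lemma Cn_pair {V : normedModType R} (U : set V) n (f g : V -> R) : open U ->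
  Cn U n f -> Cn U n g -> Cn U n (fun z => (f z, g z)).
Proof.
move=> oU; elim: n f g => [|n IH] f g.
  by move=> cf cg z Uz; exact: (cvg_pair (cf z Uz) (cg z Uz)).
move=> /CnSP[df Df] /CnSP[dg Dg]; apply/CnSP; split.
  by move=> z Uz; apply: differentiable_pair; [exact: df|exact: dg].
move=> v; apply: eq_Cn (IH _ _ (Df v) (Dg v)) => // z Uz.
have d1 := df _ Uz; have d2 := dg _ Uz.
by rewrite !deriveE ?diff_pair//; exact: differentiable_pair.
Qed.

Section real_valued.
Context {V : normedModType R}.
Implicit Types (f g : V -> R) (U : set V).

Lemma CnM U n f g : open U -> Cn U n f -> Cn U n g -> Cn U n (fun z => f z * g z).
Proof.
move=> oU; elim: n f g => [|n IH] f g.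
  by move=> cf cg z Uz; apply: continuousM; [exact: cf|exact: cg].
move=> /[dup] Cf /CnSP[df Df] /[dup] Cg /CnSP[dg Dg]; apply/CnSP; split.
  by move=> z Uz; apply: differentiableM; [exact: df|exact: dg].
move=> v; apply: eq_Cn (CnD oU (IH _ _ (CnW Cf) (Dg v)) (IH _ _ (CnW Cg) (Df v))) => //.
by move=> z Uz; rewrite deriveM//; apply: diff_derivable; [exact: df|exact: dg].
Qed.

Lemma CnN U n f : open U -> Cn U n f -> Cn U n (fun z => - f z).
Proof.
move=> oU Cf; apply: eq_Cn (CnM oU (@Cn_cst V R U n (- 1)) Cf) => // z _.
by rewrite mulN1r.
Qed.

Lemma CnB U n f g : open U -> Cn U n f -> Cn U n g -> Cn U n (fun z => f z - g z).
Proof. by move=> oU Cf Cg; apply: CnD => //; exact: CnN. Qed.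

Lemma CnX U n f k : open U -> Cn U n f -> Cn U n (fun z => f z ^+ k).
Proof.
move=> oU Cf; elim: k => [|k IH]; first exact: Cn_cst.
by apply: eq_Cn (CnM oU Cf IH) => // z _; rewrite exprS.
Qed.

Lemma derive_comp_real (h : R -> R) f z v : differentiable h (f z) ->
  differentiable f z -> 'D_v (fun z => h (f z)) z = 'D_1 h (f z) * 'D_v f z.
Proof.
move=> dh df.
have dc : differentiable (h \o f) z by exact: differentiable_comp.
rewrite (_ : (fun z => h (f z)) = h \o f)// !deriveE// diff_comp//=.
by rewrite -[X in 'd h _ X]mulr1 -[X in 'd h _ X]/(_ *: _) linearZ/= mulrC.
Qed.

Lemma Cn_comp (I : set R) U n (h : R -> R) f : open U ->
  (forall z, U z -> I (f z)) -> Cn I n h -> Cn U n f -> Cn U n (fun z => h (f z)).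
Proof.
move=> oU; elim: n h f => [|n IH] h f UI.
  by move=> ch cf z Uz; apply: continuous_comp; [exact: cf|exact/ch/UI].
move=> /CnSP[dh Dh] /[dup] Cf /CnSP[df Df]; apply/CnSP; split.
  by move=> z Uz; apply: differentiable_comp; [exact: df|exact/dh/UI].
move=> v; apply: eq_Cn (CnM oU (IH _ _ UI (Dh 1) (CnW Cf)) (Df v)) => // z Uz.
by rewrite derive_comp_real//; [exact/dh/UI|exact: df].
Qed.

End real_valued.

Section one_variable.
Implicit Types (h : R -> R) (I : set R).

Lemma derive_real h (y v : R) : differentiable h y -> 'D_v h y = v * 'D_1 h y.
Proof.
move=> dh; rewrite !deriveE//.
have : 'd h y (v *: (1 : R)) = v *: 'd h y (1 : R) by rewrite linearZ.
by rewrite /GRing.scale/= mulr1.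
Qed.

Lemma CnS_is_derive I n h h' : open I ->
  (forall y, I y -> is_derive y (1 : R) h (h' y)) -> Cn I n h' -> Cn I n.+1 h.
Proof.
move=> oI dh Ch'; have df y : I y -> differentiable h y.
  by move=> /dh[] /derivable1_diffP.
apply/CnSP; split=> // v; apply: eq_Cn (CnM oI (@Cn_cst R R I n v) Ch') => // y Iy.
by have [_ E] := dh y Iy; rewrite (derive_real v (df y Iy)) E.
Qed.

Lemma Cn_id I n : Cn I n (fun y : R => y).
Proof.
case: n => [|n]; first by move=> z _; exact: cvg_id.
apply/CnSP; split=> [z _|v].
  exact: (@ex_diff _ _ _ _ _ _ _ (is_diff_id z)).
have -> : (fun z : R => 'D_v (fun y : R => y) z) = (fun=> v).
  by apply/funext => z; rewrite derive_id.
exact: Cn_cst.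
Qed.

Lemma Cn_sin_cos I n : open I -> Cn I n (@sin R) /\ Cn I n (@cos R).
Proof.
move=> oI; elim: n => [|n [IHs IHc]].
  by split=> z _; [exact: continuous_sin|exact: continuous_cos].
split; first by apply: (CnS_is_derive oI _ IHc) => y _; exact: is_derive_sin.
by apply: (CnS_is_derive oI _ (CnN oI IHs)) => y _; exact: is_derive_cos.
Qed.

Lemma Cn_powR n (p : R) : Cn [set x : R | 0 < x] n (fun x => x `^ p).
Proof.
have oI : open [set x : R | 0 < x] by exact: open_gt.
elim: n p => [|n IH] p.
  by move=> x /= x0; exact: D1_continuous (is_derive1_powR p x0).
apply: (CnS_is_derive oI _ (CnM oI (Cn_cst _ n p) (IH (p - 1)))) => x x0.
Qed.

Lemma Cn_avg (e : R) n k h : e < 0 -> Cn [set y | e < y] n h ->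
  Cn [set y | e < y] n (avg k h).
Proof.
move=> e0; have oI : open [set y : R | e < y] by exact: open_gt.
elim: n k h => [|n IH] k h; first by move=> ch y; exact: (avg_continuous e0 ch).
move=> /CnSP[dh Dh]; apply: (@CnS_is_derive _ _ _ (avg k.+2 (fun y => 'D_1 h y))) => //.
  move=> y; apply: avg_derive => //; last exact: Cn_continuous (Dh 1).
  by move=> x /dh /diff_derivable dx; split.
exact: IH.
Qed.

End one_variable.

Lemma profile_Cn (d : nat) (sigma e : R) (a b : R -> R) : 0 < e ->
  (forall y, - e < y ->
      is_derive y (1 : R) a (- (2^-1 *
        avg d.-1 (fun x => nls_field1 d sigma (fun s : R => s `^ sigma) x (a x) (b x)) y)) /\
      is_derive y (1 : R) b (- (2^-1 *
        avg d.-1 (fun x => nls_field2 d sigma (fun s : R => s `^ sigma) x (a x) (b x)) y))) ->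
  (forall y, - e < y -> 0 < a y ^+ 2 + b y ^+ 2) ->
  forall n, Cn [set y | - e < y] n a /\ Cn [set y | - e < y] n b.
Proof.
move=> e0 dab pos; set I := [set y | _].
have oI : open I by exact: open_gt.
have Ne0 : - e < 0 by rewrite oppr_lt0.
elim=> [|n [Ca Cb]].
  by split=> y /dab[da db]; [exact: D1_continuous da|exact: D1_continuous db].
have Cg : Cn I n (fun y : R => y / 16 + (a y ^+ 2 + b y ^+ 2) `^ sigma).
  apply: CnD => //; first by apply: CnM => //; [exact: Cn_id|exact: Cn_cst].
  apply: (@Cn_comp _ [set x | 0 < x] _ _ (fun s : R => s `^ sigma)) => //.
    exact: Cn_powR.
  by apply: CnD => //; exact: CnX.
split.
  apply: (CnS_is_derive oI (fun y Iy => (dab y Iy).1)).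
  apply: CnN => //; apply: CnM => //; first exact: Cn_cst.
  apply: Cn_avg => //; apply: CnB => //; first exact: CnM.
  by apply: CnM => //; exact: Cn_cst.
apply: (CnS_is_derive oI (fun y Iy => (dab y Iy).2)).
apply: CnN => //; apply: CnM => //; first exact: Cn_cst.
apply: Cn_avg => //; apply: CnD => //; first exact: CnM.
by apply: CnM => //; exact: Cn_cst.
Qed.

End smooth_functions.

(** * Iterated integrals and L^p norms *)

Section iterated_integral.
Context {R : realType}.
Notation mu := (@lebesgue_measure R).

(* Unlike [ge0_le_integral], no measurability is required, so that it applies to
   the partial integrals of [iint]. *)
Lemma le_integral_nonmeasurable (f g : R -> \bar R) :
  (forall x, 0 <= f x)%E -> (forall x, f x <= g x)%E ->
  (\int[mu]_x f x <= \int[mu]_x g x)%E.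
Proof.
move=> f0 fg; have g0 x : (0 <= g x)%E by exact: le_trans (fg x).
rewrite !ge0_integralTE//; apply: ereal_sup_le => _ [h hf <-].
exists h => // x.
exact: le_trans (hf x) (fg x).
Qed.

Lemma iint_ge0 n (F : 'rV[R]_n -> \bar R) : (forall x, 0 <= F x)%E -> (0 <= iint F)%E.
Proof.
elim: n F => [|n IH] F F0 /=; first exact: F0.
by apply: integral_ge0 => x _; exact: IH.
Qed.

Lemma le_iint n (F G : 'rV[R]_n -> \bar R) : (forall x, 0 <= F x)%E ->
  (forall x, F x <= G x)%E -> (iint F <= iint G)%E.
Proof.
elim: n F G => [|n IH] F G F0 FG /=; first exact: FG.
apply: le_integral_nonmeasurable => x; first by apply: iint_ge0 => y.
by apply: IH => y.
Qed.

Lemma iint_prod n (h : R -> R) (a c : R) : measurable_fun setT h ->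
  (forall x, 0 <= h x) -> (\int[mu]_x (h x)%:E = c%:E)%E -> 0 <= a ->
  iint (fun x : 'rV[R]_n => (a * \prod_(i < n) h (x 0 i))%:E) = (a * c ^+ n)%:E.
Proof.
move=> mh h0 hc; have c0 : 0 <= c by rewrite -lee_fin -hc integral_ge0// => x _; rewrite lee_fin.
elim: n a => [|n IH] a a0 /=; first by rewrite big_ord0 expr0.
under eq_integral => x _.
  under [X in iint X]eq_fun => y.
    rewrite big_ord_recl (_ : rcons_row x y 0 ord0 = x); last by rewrite mxE unlift_none.
    under eq_bigr => i _ do rewrite mxE liftK.
    rewrite mulrA.
  over.
  rewrite IH ?mulr_ge0// mulrAC EFinM.
over.
rewrite ge0_integralZl_EFin//.
- by rewrite hc -EFinM exprSr mulrA.
- by move=> x _; rewrite lee_fin.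
- exact/measurable_EFinP.
- by rewrite mulr_ge0// exprn_ge0.
Qed.

Lemma iint_cube_ge n (F : 'rV[R]_n -> \bar R) (m l : R) : 0 <= m -> 0 <= l ->
  (forall x, 0 <= F x)%E ->
  (forall x : 'rV[R]_n, (forall i, 0 <= x 0 i <= l) -> (m%:E <= F x)%E) ->
  ((m * l ^+ n)%:E <= iint F)%E.
Proof.
move=> m0 l0 F0 mF; pose h : R -> R := \1_(`[0, l]%classic).
have h0 x : 0 <= h x by rewrite /h indicE.
have hc : (\int[mu]_x (h x)%:E = l%:E)%E.
  rewrite integral_indic//= setIT lebesgue_measure_itv/= lte_fin.
  by case: ltP => [_|l_le0]; [rewrite sube0|congr (_%:E); apply/eqP; rewrite eq_le l0 l_le0].
have mh : measurable_fun setT h by exact: measurable_indic.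
rewrite -(@iint_prod n h m l mh h0 hc m0); apply: le_iint => x.
  by rewrite lee_fin mulr_ge0// prodr_ge0.
have [hx|] := pselect (forall i, 0 <= x 0 i <= l).
  rewrite big1 ?mulr1; first exact: mF.
  by move=> i _; rewrite /h indicE mem_set//= in_itv/= hx.
move=> /existsNP[i hi].
rewrite (bigD1 i)//= {1}/h indicE memNset; last by rewrite /= in_itv.
by rewrite mul0r mulr0.
Qed.

Definition tail (q x : R) : R := expR (- (q * ln (1 + `|x|))).

Lemma tail_ge0 q x : 0 <= tail q x. Proof. exact: expR_ge0. Qed.

Lemma tail_continuous q : continuous (tail q).
Proof.
move=> x; apply: (@continuous_comp _ _ _ (fun x => - (q * ln (1 + `|x|))) expR); last first.
  exact: continuous_expR.
apply: continuousN; apply: continuousM; first exact: cst_continuous.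
apply: (@continuous_comp _ _ _ (fun x : R => 1 + `|x|) (@ln R)).
  by apply: continuousD; [exact: cst_continuous|exact: norm_continuous].
by apply: continuous_ln; rewrite ltr_wpDr.
Qed.

Lemma expR_Nln_cvg0 (q : R) : 0 < q ->
  expR (- (q * ln (1 + x))) @[x --> +oo%R] --> (0 : R).
Proof.
move=> q0; apply/cvgrPdist_le => e e0.
near=> x.
rewrite sub0r normrN ger0_norm ?expR_ge0// -[leRHS]lnK ?posrE// ler_expR lerNl.
rewrite mulrC -ler_pdivrMr//.
have h : expR (- ln e / q) <= 1 + x.
  apply: (@le_trans _ _ x); last by rewrite lerDr.
  by near: x; apply: nbhs_pinfty_ge; rewrite num_real.
by rewrite -[leLHS]expRK ler_ln// posrE ?expR_gt0// (lt_le_trans (expR_gt0 _) h).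
Unshelve. all: by end_near. Qed.

Lemma tail_integral (q : R) : 1 < q -> exists c : R, (\int[mu]_x (tail q x)%:E = c%:E)%E.
Proof.
move=> q1; have q10 : 0 < q - 1 by rewrite subr_gt0.
pose F (x : R) := - (expR (- ((q - 1) * ln (1 + x))) / (q - 1)).
have dF (x : R) : 0 <= x -> is_derive x (1 : R) F (expR (- (q * ln (1 + x)))).
  move=> x0; have x1 : 0 < 1 + x by rewrite ltr_wpDr.
  have D0 : is_derive x (1 : R) (fun x => 1 + x) 1 by Dsolve; ring.
  have D1 := D1_comp (is_derive1_ln x1) D0.
  rewrite /F; Dsolve.
  have -> : expR (- (q * ln (1 + x))) = expR (- ((q - 1) * ln (1 + x))) * (1 + x)^-1.
    by rewrite -{3}(lnK x1) -expRN -expRD; congr expR; ring.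
  by field; rewrite !gt_eqF.
exists (2 * (0 - F 0)).
rewrite ge0_symfun_integralT//; last 3 first.
- by move=> x; exact: tail_ge0.
- exact: tail_continuous.
- by move=> x /=; rewrite /tail normrN.
rewrite -set_itvcy (@ge0_continuous_FTC2y R (tail q) F 0 0).
- by rewrite -EFinB -EFinM.
- by move=> x _; exact: tail_ge0.
- exact/continuous_subspaceT/tail_continuous.
- have -> : 0 = - (0 / (q - 1)) :> R by rewrite mul0r oppr0.
  by apply: cvgN; apply: cvgM; [exact: expR_Nln_cvg0|exact: cvg_cst].
- by move=> x /ltW /dF [].
- by apply: cvg_at_right_filter; exact: D1_continuous (dF 0 (lexx _)).
- move=> x; rewrite in_itv/= andbT => x0; rewrite derive1E.
  by have [_ ->] := dF x (ltW x0); rewrite /tail gtr0_norm.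
Qed.

Lemma Lpnorm_fin n (p q C : R) (f : 'rV[R]_n -> R) : 1 < q -> 0 <= C ->
  (forall x, `|f x| `^ p <= C * \prod_(i < n) tail q (x 0 i)) ->
  (Lpnorm p%:E f < +oo)%E.
Proof.
move=> q1 C0 fC; rewrite /Lpnorm; apply: poweR_lty.
have [c hc] := tail_integral q1.
have mt : measurable_fun setT (tail q).
  by apply: continuous_measurable_fun; exact: tail_continuous.
have := @iint_prod n _ C c mt (tail_ge0 q) hc C0 => E.
apply: (@le_lt_trans _ _ (C * c ^+ n)%:E); last by rewrite ltry.
rewrite -E; apply: le_iint => x; first by rewrite lee_fin powR_ge0.
by rewrite lee_fin.
Qed.

Lemma Lpnorm_cube_ge n (p m l : R) (f : 'rV[R]_n -> R) : 0 < p -> 0 <= m -> 0 <= l ->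
  (forall x : 'rV[R]_n, (forall i, 0 <= x 0 i <= l) -> m <= `|f x|) ->
  ((m * l `^ (n%:R / p))%:E <= Lpnorm p%:E f)%E.
Proof.
move=> p0 m0 l0 mf; rewrite /Lpnorm.
have -> : m * l `^ (n%:R / p) = (m `^ p * l ^+ n) `^ p^-1.
  by rewrite powRM ?powR_ge0 ?exprn_ge0// -powRrM mulfV ?gt_eqF// powRr1// -powR_mulrn// -powRrM.
rewrite -poweR_EFin; apply: gt0_ler_poweR.
- by rewrite invr_ge0 ltW.
- by rewrite in_itv/= leey andbT lee_fin mulr_ge0 ?powR_ge0 ?exprn_ge0.
- by rewrite in_itv/= leey andbT iint_ge0// => x; rewrite lee_fin powR_ge0.
apply: iint_cube_ge; [exact: powR_ge0|exact: l0|by move=> x; rewrite lee_fin powR_ge0|].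
by move=> x /mf mx; rewrite lee_fin ge0_ler_powR ?nnegrE// ltW.
Qed.

Lemma Lpnormy_le n (M : R) (f : 'rV[R]_n -> R) : (forall x, `|f x| <= M) ->
  (Lpnorm +oo f <= M%:E)%E.
Proof.
move=> fM; apply: ereal_inf_lbound; rewrite /= /Defs.null_set.
rewrite (_ : [set x | (M%:E < _)%E] = set0); last first.
  by apply/seteqP; split => // x /=; rewrite lte_fin ltNge fM.
have z0 : (\int[mu]_x ((fun=> 0 : R) x)%:E = 0%:E)%E by rewrite integral0.
have mc : measurable_fun (@setT R) (fun _ : R => 0 : R) by exact: measurable_cst.
have := @iint_prod n (fun=> 0) 0 0 mc (fun=> lexx 0) z0 (lexx 0).
move=> E; rewrite /Defs.null_set.
rewrite (_ : (fun x => _) = (fun=> (0 * \prod_(i < n) 0)%:E)) ?E ?mul0r//.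
by apply/funext => x; rewrite indic0.
Qed.

Lemma Lpnormy_cube_ge n (m l : R) (f : 'rV[R]_n -> R) : 0 < l ->
  (forall x : 'rV[R]_n, (forall i, 0 <= x 0 i <= l) -> m <= `|f x|) ->
  (m%:E <= Lpnorm +oo f)%E.
Proof.
move=> l0 mf; apply: le_ereal_inf_tmp => M /= nM.
rewrite leNgt; apply/negP => Mm; move: nM; rewrite /Defs.null_set => nM.
have : ((1 * l ^+ n)%:E <= iint (fun x : 'rV[R]_n =>
    (\1_[set x | M < (`|f x|)%:E]%E x)%:E))%E.
  apply: iint_cube_ge => //; first exact: ltW.
  move=> x /mf mx; rewrite indicE mem_set//=.
  by apply: (lt_le_trans Mm); rewrite lee_fin.
by rewrite nM lee_fin mul1r leNgt exprn_gt0.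
Qed.

End iterated_integral.

(** * Self-similar functions *)

Section selfsimilar_profile.
Context {R : realType}.
Notation mu := (@lebesgue_measure R).

(* The Euler operator identity [y h' = (y h)' - h] averaged: integrate
   [d/du (u^(k+1) h(u^2 y))] over [0, 1]. *)
Lemma avg_euler k (h h' : R -> R) (e y : R) : e < 0 -> e < y ->
  (forall x, e < x -> is_derive x (1 : R) h (h' x)) ->
  (forall x, e < x -> {for x, continuous h'}) ->
  k.+1%:R * avg k h y + 2 * y * avg k.+2 h' y = h y.
Proof.
move=> e0 ey dh ch'.
pose p := Num.min y 0; pose q := Num.max y 0.
have ep : e < p by rewrite lt_min ey e0.
have pq : p <= 0 <= q by rewrite ge_min le_max !lexx !orbT.
have ypq : p <= y <= q by rewrite ge_min le_max !lexx.
have dh_ x : p <= x <= q -> is_derive x (1 : R) h (h' x).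
  by move=> /andP[px _]; apply: dh; exact: lt_le_trans px.
have ch x : p <= x <= q -> {for x, continuous h} by move=> /dh_ /D1_continuous.
have ch'_ x : p <= x <= q -> {for x, continuous h'}.
  by move=> /andP[px _]; apply: ch'; exact: lt_le_trans px.
have D (u : R) : 0 <= u <= 1 -> is_derive u (1 : R) (fun u : R => u ^+ k.+1 * h (u ^+ 2 * y))
    (k.+1%:R * (u ^+ k * h (u ^+ 2 * y)) + 2 * y * (u ^+ k.+2 * h' (u ^+ 2 * y))).
  move=> u01; have D1 : is_derive u (1 : R) (fun u : R => u ^+ 2 * y) (2 * u * y).
    by Dsolve; ring.
  have D2 := @D1_comp R h (fun u : R => u ^+ 2 * y) u _ _
    (dh_ _ (sqr_mul_itv u01 pq ypq)) D1.
  by Dsolve; rewrite !exprS; ring.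
have c1 := avg_integrand_continuous (k := k) pq ypq ch.
have c2 := avg_integrand_continuous (k := k.+2) pq ypq ch'_.
have i1 := avg_integrable k pq ypq ch.
have i2 := avg_integrable k.+2 pq ypq ch'_.
have j1 : mu.-integrable `[0, 1] (EFin \o (fun u : R => k.+1%:R * (u ^+ k * h (u ^+ 2 * y)))).
  apply: continuous_integrable_itv => u u01.
  by apply: continuousM; [exact: cst_continuous|exact: c1].
have j2 : mu.-integrable `[0, 1] (EFin \o (fun u : R => 2 * y * (u ^+ k.+2 * h' (u ^+ 2 * y)))).
  apply: continuous_integrable_itv => u u01.
  by apply: continuousM; [exact: cst_continuous|exact: c2].
rewrite /avg -RintegralZl// -RintegralZl// -RintegralD//.
have Dc (u : R) : 0 <= u <= 1 -> {for u, continuous (fun u : R => u ^+ k.+1 * h (u ^+ 2 * y))}.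
  by move=> /D /D1_continuous.
rewrite /Rintegral (@continuous_FTC2 R _ (fun u : R => u ^+ k.+1 * h (u ^+ 2 * y)))//.
- by rewrite -EFinB/= !expr1n !mul1r expr0n mul0r subr0.
- apply: continuous_in_subspaceT => u; rewrite inE/= in_itv/= => u01.
  change {for u, continuous (fun x : R => k.+1%:R * (x ^+ k * h (x ^+ 2 * y)) +
    2 * y * (x ^+ k.+2 * h' (x ^+ 2 * y)))}.
  apply: continuousD; (apply: continuousM; first exact: cst_continuous).
    exact: c1.
  exact: c2.
- split.
  + move=> u; rewrite in_itv/= => /andP[u0 u1].
    by have [|] := D u _; first by rewrite !ltW.
  + by apply: cvg_at_right_filter; apply: Dc; rewrite lexx ler01.
  + by apply: cvg_at_left_filter; apply: Dc; rewrite lexx ler01.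
- move=> u; rewrite in_itv/= => /andP[u0 u1]; rewrite derive1E.
  by have [|_ ->] := D u _; first by rewrite !ltW.
Qed.

Variables (d : nat) (sigma : R).
Hypotheses (d_gt0 : (0 < d)%N) (sigma_gt0 : 0 < sigma)
  (sd1 : 1 < sigma * d%:R) (sd2 : sigma * d%:R < 2).

Lemma avg_second_order (e : R) (h a : R -> R) : 0 < e ->
  (forall y, - e < y -> is_derive y (1 : R) a (- (2^-1 * avg d.-1 h y))) ->
  Cn [set y | - e < y] 1 h ->
  exists a1 a2 : R -> R, forall y, - e < y ->
    [/\ is_derive y (1 : R) a (a1 y), is_derive y (1 : R) a1 (a2 y) &
      4 * y * a2 y + 2 * d%:R * a1 y + h y = 0].
Proof.
move=> e0 da Ch; have Ne0 : - e < 0 by rewrite oppr_lt0.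
have /CnSP[dh Dh] := Ch.
have dh' x : - e < x -> is_derive x (1 : R) h ('D_1 h x).
  by move=> /dh /diff_derivable dx; split.
have ch' x : - e < x -> {for x, continuous (fun x => 'D_1 h x)}.
  exact: (Cn_continuous (Dh 1)).
exists (fun y => - (2^-1 * avg d.-1 h y)).
exists (fun y => - (2^-1 * avg d.-1.+2 (fun x => 'D_1 h x) y)) => y ey; split.
- exact: da.
- have D1 := avg_derive d.-1 Ne0 dh' ch' ey.
  by Dsolve; ring.
- have := avg_euler d.-1 Ne0 ey dh' ch'; rewrite prednK// => <-.
  by field.
Qed.

Let phase (y : R) := y / 8.

Let Dcos (y : R) : is_derive y (1 : R) (fun y => cos (phase y)) (- sin (phase y) / 8).
Proof.
have D1 : is_derive y (1 : R) phase 8^-1 by rewrite /phase; Dsolve; field.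
exact: D1_eq (D1_comp (is_derive_cos _) D1) _.
Qed.

Let Dsin (y : R) : is_derive y (1 : R) (fun y => sin (phase y)) (cos (phase y) / 8).
Proof.
have D1 : is_derive y (1 : R) phase 8^-1 by rewrite /phase; Dsolve; field.
exact: D1_eq (D1_comp (is_derive_sin _) D1) _.
Qed.

(* In polar notation [S = exp(-i y/8) (a + i b)] with [y = rho^2]; the phase
   removes the first-order term [i rho S' / 2] of the self-similar equation. *)
Lemma exists_selfsimilar_profile : exists S1 S2 : R -> R, exists e B : R,
  [/\ 0 < e /\ 0 < B,
    forall n, Cn [set y | - e < y] n S1 /\ Cn [set y | - e < y] n S2,
    exists T1 T2 U1 U2 : R -> R, forall y, - e < y ->
      [/\ is_derive y (1 : R) S1 (T1 y), is_derive y (1 : R) T1 (U1 y),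
        is_derive y (1 : R) S2 (T2 y), is_derive y (1 : R) T2 (U2 y) &
       - (S2 y / (2 * sigma) + y * T2 y) + (4 * y * U1 y + 2 * d%:R * T1 y)
         + (S1 y ^+ 2 + S2 y ^+ 2) `^ sigma * S1 y = 0 /\
       (S1 y / (2 * sigma) + y * T1 y) + (4 * y * U2 y + 2 * d%:R * T2 y)
         + (S1 y ^+ 2 + S2 y ^+ 2) `^ sigma * S2 y = 0],
    (forall y, - e < y -> 0 < S1 y ^+ 2 + S2 y ^+ 2) /\ S1 0 ^+ 2 + S2 0 ^+ 2 = 1 &
    forall y, 0 <= y ->
      S1 y ^+ 2 + S2 y ^+ 2 <= B * expR (- ((d%:R - sigma^-1) * ln (1 + y)))].
Proof.
have [a [b [e [B [[e0 B0] [a0 b0] dab pos decay]]]]] :=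
  exists_profile d_gt0 sigma_gt0 sd1 sd2.
have Cab := profile_Cn e0 dab pos.
set I := [set y | - e < y] in Cab *.
have oI : open I by exact: open_gt.
pose S1 y := cos (phase y) * a y + sin (phase y) * b y.
pose S2 y := cos (phase y) * b y - sin (phase y) * a y.
have SE y : S1 y ^+ 2 + S2 y ^+ 2 = a y ^+ 2 + b y ^+ 2.
  have cs := cos2Dsin2 (phase y).
  have -> : S1 y ^+ 2 + S2 y ^+ 2 = (cos (phase y) ^+ 2 + sin (phase y) ^+ 2)
    * (a y ^+ 2 + b y ^+ 2) by rewrite /S1 /S2; ring.
  by rewrite cs mul1r.
have Cphase n : Cn I n phase by apply: CnM => //; [exact: Cn_id|exact: Cn_cst].
have Ccos n : Cn I n (fun y => cos (phase y)).
  apply: (@Cn_comp _ _ setT _ _ (@cos R)) => //.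
  by have [_] := @Cn_sin_cos R setT n openT.
have Csin n : Cn I n (fun y => sin (phase y)).
  apply: (@Cn_comp _ _ setT _ _ (@sin R)) => //.
  by have [] := @Cn_sin_cos R setT n openT.
pose g := fun s : R => s `^ sigma.
have Cg n : Cn I n (fun y : R => y / 16 + (a y ^+ 2 + b y ^+ 2) `^ sigma).
  have [Ca Cb] := Cab n.
  apply: CnD => //; first by apply: CnM => //; [exact: Cn_id|exact: Cn_cst].
  apply: (@Cn_comp _ _ [set x | 0 < x] _ _ (fun s : R => s `^ sigma)) => //.
    exact: Cn_powR.
  by apply: CnD => //; exact: CnX.
have Ch1 n : Cn I n (fun x : R => nls_field1 d sigma g x (a x) (b x)).
  have [Ca Cb] := Cab n; apply: CnB => //; first exact: CnM.
  by apply: CnM => //; exact: Cn_cst.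
have Ch2 n : Cn I n (fun x : R => nls_field2 d sigma g x (a x) (b x)).
  have [Ca Cb] := Cab n; apply: CnD => //; first exact: CnM.
  by apply: CnM => //; exact: Cn_cst.
have [a1 [a2 ha]] := avg_second_order e0 (fun y ey => (dab y ey).1) (Ch1 1%N).
have [b1 [b2 hb]] := avg_second_order e0 (fun y ey => (dab y ey).2) (Ch2 1%N).
pose T1 y := cos (phase y) * a1 y + sin (phase y) * b1 y + S2 y / 8.
pose T2 y := cos (phase y) * b1 y - sin (phase y) * a1 y - S1 y / 8.
pose U1 y := cos (phase y) * a2 y + sin (phase y) * b2 y
  + (cos (phase y) * b1 y - sin (phase y) * a1 y) / 8 + T2 y / 8.
pose U2 y := cos (phase y) * b2 y - sin (phase y) * a2 y
  - (cos (phase y) * a1 y + sin (phase y) * b1 y) / 8 - T1 y / 8.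
exists S1, S2, e, B; split.
- by split.
- move=> n; have [Ca Cb] := Cab n.
  by split; [apply: CnD => //; exact: CnM|apply: CnB => //; exact: CnM].
- exists T1, T2, U1, U2 => y ey.
  have [da da1 ea] := ha y ey; have [db db1 eb] := hb y ey.
  have dc := Dcos y; have ds := Dsin y.
  have dS1 : is_derive y (1 : R) S1 (T1 y).
    by rewrite /S1; eapply D1_eq; [eapply D1_add; eapply D1_mul; eassumption|rewrite /T1 /S2 /=; field].
  have dS2 : is_derive y (1 : R) S2 (T2 y).
    by rewrite /S2; eapply D1_eq; [eapply D1_sub; eapply D1_mul; eassumption|rewrite /T2 /S1 /=; field].
  have dT1 : is_derive y (1 : R) T1 (U1 y).
    rewrite /T1; eapply D1_eq.
      by eapply D1_add; [eapply D1_add; eapply D1_mul; eassumption|eapply D1_mul; [eassumption|eapply D1_cst]].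
    by rewrite /U1 /=; field.
  have dT2 : is_derive y (1 : R) T2 (U2 y).
    rewrite /T2; eapply D1_eq.
      by eapply D1_sub; [eapply D1_sub; eapply D1_mul; eassumption|eapply D1_mul; [eassumption|eapply D1_cst]].
    by rewrite /U2 /=; field.
  split=> //; rewrite SE.
  move: ea eb; rewrite /nls_field1 /nls_field2 /g.
  set s := _ `^ sigma => ea eb.
  have ea' : 4 * y * a2 y = - (2 * d%:R * a1 y + ((y / 16 + s) * a y -
    ((2 * sigma)^-1 - d%:R / 4) * b y)) by lra.
  have eb' : 4 * y * b2 y = - (2 * d%:R * b1 y + ((y / 16 + s) * b y +
    ((2 * sigma)^-1 - d%:R / 4) * a y)) by lra.
  have sN : sigma != 0 by rewrite gt_eqF.
  split.
    have -> : 4 * y * U1 y = cos (phase y) * (4 * y * a2 y) + sin (phase y) * (4 * y * b2 y)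
      + 4 * y * ((cos (phase y) * b1 y - sin (phase y) * a1 y) / 8 + T2 y / 8).
      by rewrite /U1; field.
    by rewrite ea' eb' /T1 /T2 /S1 /S2; field.
  have -> : 4 * y * U2 y = cos (phase y) * (4 * y * b2 y) - sin (phase y) * (4 * y * a2 y)
      - 4 * y * ((cos (phase y) * a1 y + sin (phase y) * b1 y) / 8 + T1 y / 8).
    by rewrite /U2; field.
  by rewrite ea' eb' /T1 /T2 /S1 /S2; field.
- split; first by move=> y /pos; rewrite SE.
  by rewrite SE a0 b0 expr1n expr0n addr0.
- by move=> y /decay; rewrite SE.
Qed.

End selfsimilar_profile.

Section spacetime.
Context {R : realType} {d : nat}.
Local Notation V := (R * 'rV[R]_d)%type.

Definition time_coord (z : V) : R := z.1.
Definition space_coord (j : 'I_d) (z : V) : R := z.2 0 j.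

Let time_coord_linear : linear time_coord. Proof. by []. Qed.
Let space_coord_linear j : linear (space_coord j).
Proof. by move=> k x y; rewrite /space_coord/= !mxE. Qed.

HB.instance Definition _ :=
  GRing.isLinear.Build R V R _ time_coord time_coord_linear.
HB.instance Definition _ j :=
  GRing.isLinear.Build R V R _ (space_coord j) (space_coord_linear j).

Lemma time_coord_continuous : continuous time_coord.
Proof. by move=> z; exact: cvg_fst. Qed.

Lemma space_coord_continuous j : continuous (space_coord j).
Proof.
move=> z; apply: (@continuous_comp _ _ _ (fun z : V => z.2) (fun x : 'rV[R]_d => x 0 j)).
  exact: cvg_snd.
exact: coord_continuous.
Qed.

Definition past (T : R) : set V := [set z | z.1 < T].

Lemma open_past T : open (past T).
Proof.
rewrite (_ : past T = time_coord @^-1` [set t | t < T])//.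
apply: open_comp; last exact: open_lt.
by move=> z _; exact: time_coord_continuous.
Qed.

Definition time_left (z : V) : R := 1 - z.1.
Definition sqnorm (z : V) : R := \sum_(j < d) z.2 0 j ^+ 2.

Lemma Cn_time_left U n : open U -> Cn U n time_left.
Proof.
move=> oU; apply: (CnB oU (@Cn_cst _ V R U n 1)).
exact: (Cn_linear _ _ time_coord_continuous).
Qed.

Lemma Cn_sum U n (r : seq 'I_d) (f : 'I_d -> V -> R) : open U ->
  (forall j, Cn U n (f j)) -> Cn U n (fun z => \sum_(j <- r) f j z).
Proof.
move=> oU Cf; elim: r => [|j r IH].
  by under eq_fun do rewrite big_nil; exact: Cn_cst.
by under eq_fun do rewrite big_cons; exact: CnD.
Qed.

Lemma Cn_sqnorm U n : open U -> Cn U n sqnorm.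
Proof.
move=> oU; apply: Cn_sum => // j; apply: CnX => //.
exact: (Cn_linear _ _ (@space_coord_continuous j)).
Qed.

Definition has_dir_derive (v : V) (f : V -> R) (z : V) (df : R) :=
  differentiable f z /\ 'D_v f z = df.

Lemma has_dir_deriveM v f g z df dg : has_dir_derive v f z df ->
  has_dir_derive v g z dg ->
  has_dir_derive v (fun z => f z * g z) z (f z * dg + g z * df).
Proof.
move=> [df_ <-] [dg_ <-]; split; first exact: differentiableM.
by rewrite deriveM//; exact: diff_derivable.
Qed.

Lemma has_dir_derive_comp v (h : R -> R) f z dh df : is_derive (f z) (1 : R) h dh ->
  has_dir_derive v f z df -> has_dir_derive v (fun z => h (f z)) z (dh * df).
Proof.
move=> [/derivable1_diffP dh_ hE] [df_ <-]; split; first exact: differentiable_comp.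
by rewrite derive_comp_real// hE.
Qed.

Lemma derive_time_left v z : has_dir_derive v time_left z (- v.1).
Proof.
have dl : differentiable (time_coord : {linear V -> R}) z.
  exact/linear_differentiable/time_coord_continuous.
split; first by apply: differentiableB => //; exact: differentiable_cst.
rewrite (_ : time_left = (cst 1 - (time_coord : V -> R))%R)//.
rewrite deriveB ?derive_cst ?sub0r; last 2 first.
- exact: derivable_cst.
- exact: diff_derivable.
by rewrite deriveE// diff_lin//; exact: time_coord_continuous.
Qed.

Lemma derive_space_coord v j z : has_dir_derive v (space_coord j) z (v.2 0 j).
Proof.
have dl : differentiable (space_coord j : {linear V -> R}) z.
  exact/linear_differentiable/space_coord_continuous.
split=> //; rewrite deriveE// diff_lin//; exact: space_coord_continuous.
Qed.

Lemma derive_sqnorm v z :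
  has_dir_derive v sqnorm z (\sum_(j < d) 2 * z.2 0 j * v.2 0 j).
Proof.
rewrite /sqnorm; elim: (index_enum _) => [|j r [IHd IHe]].
  rewrite big_nil; under eq_fun do rewrite big_nil.
  by split; [exact: differentiable_cst|rewrite derive_cst].
rewrite big_cons; under eq_fun do rewrite big_cons.
have [d1 e1] := has_dir_deriveM (derive_space_coord v j z) (derive_space_coord v j z).
have {}d1 : differentiable (fun z : V => z.2 0 j ^+ 2) z by [].
have {}e1 : 'D_v (fun z : V => z.2 0 j ^+ 2) z = 2 * z.2 0 j * v.2 0 j.
  by rewrite [LHS]e1 /space_coord; ring.
split; first exact: differentiableD.
rewrite deriveD; [by rewrite e1 IHe|exact: diff_derivable|exact: diff_derivable].
Qed.

Definition selfsim_var (z : V) : R := sqnorm z * time_left z `^ (-1).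
Definition selfsim (q : R) (S : R -> R) (z : V) : R :=
  time_left z `^ (- q) * S (selfsim_var z).

Lemma time_left_gt0 z : past 1 z -> 0 < time_left z.
Proof. by rewrite /past /time_left/= subr_gt0. Qed.

Lemma sqnorm_ge0 z : 0 <= sqnorm z.
Proof. by apply: sumr_ge0 => j _; exact: sqr_ge0. Qed.

Lemma selfsim_var_ge0 z : 0 <= selfsim_var z.
Proof. by rewrite mulr_ge0 ?sqnorm_ge0 ?powR_ge0. Qed.

Lemma Cn_selfsim q S n e : 0 < e -> Cn [set y : R | - e < y] n S ->
  Cn (past 1) n (selfsim q S).
Proof.
move=> e0 CS; have oU := @open_past 1.
have Cp p : Cn (past 1) n (fun z => time_left z `^ p).
  apply: (@Cn_comp _ _ [set x : R | 0 < x] _ _ (fun x => x `^ p)) => //.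
  - by move=> z; exact: time_left_gt0.
  - exact: Cn_powR.
  - exact: Cn_time_left.
apply: CnM => //; apply: (@Cn_comp _ _ [set y : R | - e < y]) => //.
  by move=> z _ /=; apply: lt_le_trans (selfsim_var_ge0 z); rewrite oppr_lt0.
by apply: CnM => //; exact: Cn_sqnorm.
Qed.

Lemma derive_selfsim q (S T : R -> R) v z : past 1 z ->
  is_derive (selfsim_var z) (1 : R) S (T (selfsim_var z)) ->
  has_dir_derive v (selfsim q S) z
    (time_left z `^ (- q) * time_left z `^ (-1) *
     (v.1 * (q * S (selfsim_var z) + selfsim_var z * T (selfsim_var z)) +
      T (selfsim_var z) * \sum_(j < d) 2 * z.2 0 j * v.2 0 j)).
Proof.
move=> /time_left_gt0 t0 dS.
have powS p : time_left z `^ (p - 1) = time_left z `^ p * time_left z `^ (-1).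
  by rewrite powRD// (gt_eqF t0) implybT.
have dp p : has_dir_derive v (fun z => time_left z `^ p) z
    (p * time_left z `^ (p - 1) * - v.1).
  by apply: (has_dir_derive_comp (h := fun x => x `^ p)); [exact: is_derive1_powR|exact: derive_time_left].
have dY := has_dir_deriveM (derive_sqnorm v z) (dp (-1)).
have dSY := has_dir_derive_comp dS dY.
have [d1 e1] := has_dir_deriveM (dp (- q)) dSY.
split; first exact: d1.
rewrite [LHS]e1 !powS /selfsim_var; ring.
Qed.

Lemma sum_e_space (z : V) j : \sum_(k < d) 2 * z.2 0 k * (@e_space R d j).2 0 k = 2 * z.2 0 j.
Proof.
rewrite (bigD1 j)//= mxE !eqxx mulr1 big1 ?addr0// => k kj.
by rewrite mxE eqxx (negbTE kj) mulr0.
Qed.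

Lemma derive_time_selfsim q (S T : R -> R) z : past 1 z ->
  is_derive (selfsim_var z) (1 : R) S (T (selfsim_var z)) ->
  'D_(e_time d) (selfsim q S) z = time_left z `^ (- q) * time_left z `^ (-1) *
    (q * S (selfsim_var z) + selfsim_var z * T (selfsim_var z)).
Proof.
move=> Uz dS; have [_ ->] := derive_selfsim q (e_time d) Uz dS.
by rewrite /e_time/= mul1r big1 ?mulr0 ?addr0// => j _; rewrite mxE mulr0.
Qed.

Lemma derive_space_selfsim q (S T : R -> R) z j : past 1 z ->
  is_derive (selfsim_var z) (1 : R) S (T (selfsim_var z)) ->
  'D_(e_space j) (selfsim q S) z = 2 * space_coord j z * selfsim (q + 1) T z.
Proof.
move=> Uz dS; have [_ ->] := derive_selfsim q (e_space j) Uz dS.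
rewrite sum_e_space /e_space/= mul0r add0r /selfsim /space_coord opprD powRD.
  by ring.
by rewrite (gt_eqF (time_left_gt0 Uz)) implybT.
Qed.

Lemma laplacian_selfsim q (S T U : R -> R) z : past 1 z ->
  (forall y : R, 0 <= y -> is_derive y (1 : R) S (T y)) ->
  (forall y : R, 0 <= y -> is_derive y (1 : R) T (U y)) ->
  \sum_(j < d) 'D_(e_space j) (fun z => 'D_(e_space j) (selfsim q S) z) z =
  time_left z `^ (- q) * time_left z `^ (-1) *
  (4 * selfsim_var z * U (selfsim_var z) + 2 * d%:R * T (selfsim_var z)).
Proof.
move=> Uz dS dT; have t0 := time_left_gt0 Uz.
have powS p : time_left z `^ (- (p + 1)) = time_left z `^ (- p) * time_left z `^ (-1).
  by rewrite opprD powRD// (gt_eqF t0) implybT.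
have D2 j : 'D_(e_space j) (fun z => 'D_(e_space j) (selfsim q S) z) z =
    time_left z `^ (- q) * time_left z `^ (-1) *
    (4 * U (selfsim_var z) * (z.2 0 j ^+ 2 * time_left z `^ (-1)) + 2 * T (selfsim_var z)).
  rewrite (@near_eq_derive _ _ _ _ (fun z => 2 * space_coord j z * selfsim (q + 1) T z)); last first.
    have oU : open_nbhs z (past 1) by split=> //; exact: open_past.
    apply: filterS (open_nbhs_nbhs oU) => x Ux.
    by apply: derive_space_selfsim => //; apply: dS; exact: selfsim_var_ge0.
  have c2 : has_dir_derive (e_space j) (fun=> 2) z 0.
    by split; [exact: differentiable_cst|rewrite derive_cst].
  have h1 := has_dir_deriveM c2 (derive_space_coord (e_space j) j z).
  have h2 := derive_selfsim (q + 1) (e_space j) Uz (dT _ (selfsim_var_ge0 z)).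
  have [_ ->] := has_dir_deriveM h1 h2.
  rewrite sum_e_space /e_space/= mul0r add0r mxE !eqxx mulr1 mulr0 addr0.
  by rewrite /selfsim !powS /space_coord; ring.
under eq_bigr => j _ do rewrite D2.
rewrite -mulr_sumr big_split/= -mulr_sumr -mulr_suml sumr_const card_ord.
by rewrite /selfsim_var /sqnorm -mulr_natr; ring.
Qed.

End spacetime.

(** * Blow-up *)

Section blowup.
Context {R : realType}.

Lemma sum_pair (I : Type) (r : seq I) (f g : I -> R) :
  \sum_(j <- r) (f j, g j) = (\sum_(j <- r) f j, \sum_(j <- r) g j).
Proof. by elim: r => [|j r IH]; rewrite ?big_nil// !big_cons IH. Qed.

Lemma cvg_blowup (F : R -> \bar R) (c eta : R) : 0 < c -> 0 < eta ->
  (forall t, 0 <= t < 1 -> ((c * (1 - t) `^ (- eta))%:E <= F t)%E) ->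
  F t @[t --> 1^'-] --> +oo%E.
Proof.
move=> c0 eta0 hF; apply/cvgeyPger => A _.
pose X := (`|A| + 1) / c; have X0 : 0 < X by rewrite divr_gt0// ltr_wpDl.
pose e0 := X `^ (- eta^-1); have e00 : 0 < e0 by rewrite powR_gt0.
near=> t.
have t1 : t < 1 by near: t; exact: nbhs_left_lt.
have t0 : 0 < t by near: t; apply: nbhs_left_gt.
have te : 1 - e0 < t by near: t; apply: nbhs_left_gt; rewrite ltrBlDr ltrDl.
apply: le_trans (hF t _); last by rewrite (ltW t0).
rewrite lee_fin; apply: (le_trans (ler_norm A)).
apply: (@le_trans _ _ (c * X)).
  by rewrite /X mulrC divfK ?gt_eqF// lerDl.
rewrite ler_pM2l// powRN -[leLHS]invrK lef_pV2 ?posrE ?invr_gt0 ?powR_gt0 ?subr_gt0//.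
have -> : X^-1 = e0 `^ eta.
  by rewrite /e0 -powRrM mulNr mulVf ?gt_eqF// powR_inv1// ltW.
apply: ge0_ler_powR; rewrite ?nnegrE ?(ltW eta0) ?(ltW e00) ?subr_ge0 ?(ltW t1)//.
lra.
Unshelve. all: by end_near. Qed.

Variables (d : nat) (sigma : R).
Hypotheses (d_gt0 : (0 < d)%N) (sigma_gt0 : 0 < sigma)
  (sd1 : 1 < sigma * d%:R).
Variables (S1 S2 : R -> R) (e B : R).
Hypotheses (e_gt0 : 0 < e) (B_gt0 : 0 < B).
Hypothesis CS : forall n, Cn [set y | - e < y] n S1 /\ Cn [set y | - e < y] n S2.

Let q := (2 * sigma)^-1.
Let q_gt0 : 0 < q. Proof. by rewrite invr_gt0 mulr_gt0. Qed.
Local Notation V := (R * 'rV[R]_d)%type.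

Definition selfsim_solution (z : V) : R * R := (selfsim q S1 z, selfsim q S2 z).

Let s y := S1 y ^+ 2 + S2 y ^+ 2.

Let s_ge0 y : 0 <= s y. Proof. by rewrite addr_ge0 ?sqr_ge0. Qed.

Lemma cabs_selfsim z :
  cabs (selfsim_solution z) = time_left z `^ (- q) * Num.sqrt (s (selfsim_var z)).
Proof.
rewrite /cabs /selfsim_solution /selfsim/= !exprMn -mulrDr sqrtrM ?sqr_ge0//.
by rewrite sqrtr_sqr ger0_norm// powR_ge0.
Qed.

Lemma Cn_selfsim_solution n : Cn (past 1) n selfsim_solution.
Proof.
have [C1 C2] := CS n; apply: Cn_pair; first exact: open_past.
  exact: Cn_selfsim e_gt0 C1.
exact: Cn_selfsim e_gt0 C2.
Qed.

Lemma selfsim_solution_smooth : smooth_on [set z : V | 0 < z.1 < 1] selfsim_solution.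
Proof.
move=> vs z /= /andP[_ z1].
exact: (Cn_smooth Cn_selfsim_solution).
Qed.

Lemma selfsim_solution_continuous :
  {within [set z : V | 0 <= z.1 < 1], continuous selfsim_solution}.
Proof.
apply: continuous_in_subspaceT => z; rewrite inE/= => /andP[_ z1].
exact: (Cn_continuous (Cn_selfsim_solution 0)).
Qed.

Let derive_pair (f g : V -> R) v z : differentiable f z -> differentiable g z ->
  'D_v (fun z => (f z, g z)) z = ('D_v f z, 'D_v g z).
Proof.
move=> df dg; rewrite !deriveE ?diff_pair//; exact: differentiable_pair.
Qed.

Section equation.
Variables (T1 T2 U1 U2 : R -> R).
Hypothesis profile : forall y, - e < y ->
  [/\ is_derive y (1 : R) S1 (T1 y), is_derive y (1 : R) T1 (U1 y),
      is_derive y (1 : R) S2 (T2 y), is_derive y (1 : R) T2 (U2 y) &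
     - (S2 y / (2 * sigma) + y * T2 y) + (4 * y * U1 y + 2 * d%:R * T1 y)
       + (S1 y ^+ 2 + S2 y ^+ 2) `^ sigma * S1 y = 0 /\
     (S1 y / (2 * sigma) + y * T1 y) + (4 * y * U2 y + 2 * d%:R * T2 y)
       + (S1 y ^+ 2 + S2 y ^+ 2) `^ sigma * S2 y = 0].

Lemma selfsim_solution_nls z : past 1 z ->
  mulI ('D_(e_time d) selfsim_solution z) + laplacian selfsim_solution z
  + (cabs (selfsim_solution z) `^ (2 * sigma)) *: selfsim_solution z = 0.
Proof.
move=> Uz; have t0 := time_left_gt0 Uz.
have oU := @open_past R d 1.
have pos y : 0 <= y -> - e < y by apply: lt_le_trans; rewrite oppr_lt0.
have dS1 (y : R) (y0 : 0 <= y) : is_derive y (1 : R) S1 (T1 y) by case: (profile (pos y y0)).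
have dS2 (y : R) (y0 : 0 <= y) : is_derive y (1 : R) S2 (T2 y) by case: (profile (pos y y0)).
have dT1 (y : R) (y0 : 0 <= y) : is_derive y (1 : R) T1 (U1 y) by case: (profile (pos y y0)).
have dT2 (y : R) (y0 : 0 <= y) : is_derive y (1 : R) T2 (U2 y) by case: (profile (pos y y0)).
have [C1 C2] := CS 2%N.
have /CnSP[df1 Df1] := Cn_selfsim (d := d) q e_gt0 C1.
have /CnSP[df2 Df2] := Cn_selfsim (d := d) q e_gt0 C2.
have Y0 := selfsim_var_ge0 z.
have timeE : 'D_(e_time d) selfsim_solution z =
    (time_left z `^ (- q) * time_left z `^ (-1) *
      (q * S1 (selfsim_var z) + selfsim_var z * T1 (selfsim_var z)),
     time_left z `^ (- q) * time_left z `^ (-1) *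
      (q * S2 (selfsim_var z) + selfsim_var z * T2 (selfsim_var z))).
  rewrite derive_pair; [|exact: df1|exact: df2].
  by rewrite (derive_time_selfsim q Uz (dS1 _ Y0)) (derive_time_selfsim q Uz (dS2 _ Y0)).
have lapE : laplacian selfsim_solution z =
    (time_left z `^ (- q) * time_left z `^ (-1) *
      (4 * selfsim_var z * U1 (selfsim_var z) + 2 * d%:R * T1 (selfsim_var z)),
     time_left z `^ (- q) * time_left z `^ (-1) *
      (4 * selfsim_var z * U2 (selfsim_var z) + 2 * d%:R * T2 (selfsim_var z))).
  rewrite -(laplacian_selfsim q Uz dS1 dT1) -(laplacian_selfsim q Uz dS2 dT2).
  rewrite /laplacian.
  have E j : 'D_(e_space j) ('D_(e_space j) selfsim_solution) z =
    ('D_(e_space j) (fun z => 'D_(e_space j) (selfsim q S1) z) z,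
     'D_(e_space j) (fun z => 'D_(e_space j) (selfsim q S2) z) z).
    rewrite -derive_pair; last 2 first.
    - by have /CnSP[h _] := Df1 (e_space j); exact: h.
    - by have /CnSP[h _] := Df2 (e_space j); exact: h.
    apply: near_eq_derive.
    apply: filterS (open_nbhs_nbhs (conj oU Uz)) => x Ux.
    by rewrite derive_pair; [|exact: df1|exact: df2].
  under eq_bigr => j _ do rewrite E.
  exact: sum_pair.
have absE : cabs (selfsim_solution z) `^ (2 * sigma) =
    time_left z `^ (-1) * s (selfsim_var z) `^ sigma.
  rewrite cabs_selfsim powRM ?powR_ge0 ?sqrtr_ge0// -powRrM; congr (_ `^ _ * _).
    by rewrite /q; field; rewrite gt_eqF.
  by rewrite -powR12_sqrt// -powRrM; congr (_ `^ _); field.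
have [_ _ _ _ [e1 e2]] := profile (pos _ Y0).
rewrite timeE lapE absE /mulI /selfsim_solution /selfsim/=.
move: e1 e2; rewrite -/(s _).
move: (time_left z `^ (- q)) (time_left z `^ (-1)) (selfsim_var z) => P i Y e1 e2.
change ((- (P * i * (q * S2 Y + Y * T2 Y)) + P * i * (4 * Y * U1 Y + 2 * d%:R * T1 Y)
    + i * s Y `^ sigma * (P * S1 Y),
  P * i * (q * S1 Y + Y * T1 Y) + P * i * (4 * Y * U2 Y + 2 * d%:R * T2 Y)
    + i * s Y `^ sigma * (P * S2 Y)) = (0, 0)).
congr (_, _).
  rewrite -[RHS](mulr0 (P * i)) -e1 /q; ring.
rewrite -[RHS](mulr0 (P * i)) -e2 /q; ring.
Qed.

End equation.

Let kappa := d%:R - sigma^-1.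
Let kappa_gt0 : 0 < kappa.
Proof.
have -> : kappa = (sigma * d%:R - 1) / sigma by rewrite /kappa; field; rewrite gt_eqF.
by rewrite divr_gt0// subr_gt0.
Qed.

Hypothesis s0 : s 0 = 1.
Hypothesis decay : forall y, 0 <= y -> s y <= B * expR (- (kappa * ln (1 + y))).

Let prof (t : R) (x : 'rV[R]_d) : R := cabs (selfsim_solution (t, x)).

Let prof_ge0 t x : 0 <= prof t x. Proof. exact: sqrtr_ge0. Qed.

Let amp (t : R) := (1 - t) `^ (- q) * Num.sqrt B.

Let prof_le (t : R) x : 0 <= t < 1 ->
  prof t x <= amp t * expR (- (kappa / 2 * ln (1 + sqnorm (t, x)))).
Proof.
move=> /andP[t0 t1]; rewrite /prof cabs_selfsim /amp -mulrA.
have tl : time_left (t, x) = 1 - t by [].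
rewrite tl ler_wpM2l ?powR_ge0//.
set Y := selfsim_var _; set N := sqnorm _.
have N0 : 0 <= N by exact: sqnorm_ge0.
have NY : N <= Y.
  rewrite /Y /selfsim_var tl ler_peMr// powR_inv1 ?subr_ge0 ?(ltW t1)//.
  by rewrite invf_ge1 ?subr_gt0// gerBl.
have -> : expR (- (kappa / 2 * ln (1 + N))) = Num.sqrt (expR (- (kappa * ln (1 + N)))).
  rewrite -powR12_sqrt ?expR_ge0// -expRM; congr expR; by field.
rewrite -sqrtrM ?(ltW B_gt0)// ler_wsqrtr//.
apply: (le_trans (decay (le_trans N0 NY))).
rewrite ler_pM2l// ler_expR lerN2 ler_pM2l// ler_ln ?posrE ?ltr_wpDr ?(le_trans N0)//.
by rewrite lerD2l.
Qed.

Lemma selfsim_solution_Lpnorm_fin (p t : R) : 0 < p -> d%:R < kappa * p -> 0 <= t < 1 ->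
  (Lpnorm p%:E (fun x : 'rV[R]_d => cabs (selfsim_solution (t, x))) < +oo)%E.
Proof.
move=> p0 kp t01; have dR : 0 < d%:R :> R by rewrite ltr0n.
pose q' := kappa * p / d%:R.
have q'1 : 1 < q' by rewrite /q' ltr_pdivlMr// mul1r.
have A0 : 0 <= amp t by rewrite mulr_ge0 ?powR_ge0 ?sqrtr_ge0.
apply: (@Lpnorm_fin R d p q' (amp t `^ p * expR (kappa * p / 2 * ln 2))) => //.
  by rewrite mulr_ge0 ?powR_ge0 ?expR_ge0.
move=> x; rewrite -/(prof t x) ger0_norm//.
have h := prof_le x t01; set N := sqnorm _ in h.
have N0 : 0 <= N by exact: sqnorm_ge0.
apply: (@le_trans _ _ ((amp t * expR (- (kappa / 2 * ln (1 + N)))) `^ p)).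
  apply: ge0_ler_powR => //; first exact: ltW.
    by rewrite nnegrE.
  by rewrite nnegrE; apply: mulr_ge0 => //; exact: expR_ge0.
rewrite powRM ?expR_ge0// -(mulrA (amp t `^ p)) ler_wpM2l ?powR_ge0// -expRM.
rewrite /tail -expR_sum -expRD ler_expR sumrN.
have : \sum_(i < d) q' * ln (1 + `|x 0 i|) <= \sum_(i < d) q' * ((ln 2 + ln (1 + N)) / 2).
  apply: ler_sum => i _; rewrite ler_pM2l; last exact: lt_trans q'1.
  rewrite ler_pdivlMr// mulr_natr -lnXn ?ltr_wpDr// -lnM ?posrE ?ltr_wpDr//.
  rewrite ler_ln ?posrE ?exprn_gt0 ?mulr_gt0 ?ltr_wpDr//.
  have : x 0 i ^+ 2 <= N.
    by rewrite /N /sqnorm (bigD1 i)//= lerDl sumr_ge0// => j _; exact: sqr_ge0.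
  rewrite -(real_normK (num_real (x 0 i))).
  have := sqr_ge0 (`|x 0 i| - 1); lra.
rewrite sumr_const card_ord -[X in _ <= X -> _]mulr_natr.
have -> : q' * ((ln 2 + ln (1 + N)) / 2) * d%:R = kappa * p / 2 * (ln 2 + ln (1 + N)).
  by rewrite /q'; field; rewrite gt_eqF.
lra.
Qed.

Lemma selfsim_solution_Lpnormy_fin (t : R) : 0 <= t < 1 ->
  (Lpnorm +oo (fun x : 'rV[R]_d => cabs (selfsim_solution (t, x))) < +oo)%E.
Proof.
move=> t01; apply: (@le_lt_trans _ _ (amp t)%:E); last by rewrite ltry.
apply: Lpnormy_le => x; rewrite -/(prof t x) ger0_norm//.
apply: (le_trans (prof_le x t01)); rewrite ler_piMr ?mulr_ge0 ?powR_ge0 ?sqrtr_ge0//.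
rewrite -[leRHS]expR0 ler_expR oppr_le0 mulr_ge0 ?divr_ge0 ?(ltW kappa_gt0)//.
by rewrite ln_ge0// lerDl sqnorm_ge0.
Qed.

Let exists_core : exists2 del, 0 < del &
  forall t (x : 'rV[R]_d), 0 <= t < 1 ->
    (forall i : 'I_d, 0 <= x 0 i <= Num.sqrt ((1 - t) * del)) ->
    2^-1 * (1 - t) `^ (- q) <= `|prof t x|.
Proof.
have dR : 0 < d%:R :> R by rewrite ltr0n.
have [C1 C2] := CS 0.
have sq (f : R -> R) : Cn [set y | - e < y] 0 f -> {for (0 : R), continuous (fun y => f y ^+ 2)}.
  move=> Cf; apply: (@continuous_comp _ _ _ f (fun x : R => x ^+ 2)).
    by apply: (Cn_continuous Cf); rewrite /= oppr_lt0.
  exact: exprn_continuous.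
have cs : {for (0 : R), continuous s} by apply: continuousD; exact: sq.
have : \forall y \near (0 : R), 4^-1 < s y.
  by apply: (cvgr_gt _ cs); rewrite s0; lra.
move=> /nbhs_ballP[eps /= eps0 heps].
exists (eps / 2 / d%:R); first by rewrite !divr_gt0.
move=> t x /andP[t0 t1] hx.
have tl : time_left (t, x) = 1 - t by [].
have tau0 : 0 < 1 - t by rewrite subr_gt0.
have Yeps : selfsim_var (t, x) <= eps / 2.
  rewrite /selfsim_var tl powR_inv1 ?(ltW tau0)// ler_pdivrMr//.
  apply: (@le_trans _ _ (\sum_(j < d) (1 - t) * (eps / 2 / d%:R))).
    apply: ler_sum => j _ /=; have /andP[x0 x1] := hx j.
    rewrite -[leRHS]sqr_sqrtr; last by rewrite mulr_ge0 ?divr_ge0 ?(ltW tau0) ?(ltW eps0).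
    by rewrite ler_sqr ?nnegrE// (le_trans x0).
  rewrite sumr_const card_ord -[leLHS]mulr_natr.
  by rewrite -mulrA divfK ?gt_eqF// mulrC.
rewrite ger0_norm// /prof cabs_selfsim tl mulrC ler_wpM2l ?powR_ge0//.
have sY : 4^-1 <= s (selfsim_var (t, x)).
  apply/ltW/heps; rewrite /ball/= sub0r normrN ger0_norm ?selfsim_var_ge0//.
  by apply: (le_lt_trans Yeps); lra.
rewrite -[leLHS]ger0_norm// -sqrtr_sqr ler_wsqrtr//; apply: le_trans sY.
by rewrite exprVn; lra.
Qed.

Lemma selfsim_solution_blowup (p : R) : 0 < p -> sigma * d%:R < p ->
  Lpnorm p%:E (fun x : 'rV[R]_d => cabs (selfsim_solution (t, x))) @[t --> 1^'-] --> +oo%E.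
Proof.
move=> p0 sdp; have [del del0 core] := exists_core.
apply: (@cvg_blowup _ (2^-1 * del `^ (d%:R / (2 * p))) (q - d%:R / (2 * p))).
- by rewrite mulr_gt0 ?invr_gt0// powR_gt0.
- have -> : q - d%:R / (2 * p) = (p - sigma * d%:R) / (2 * sigma * p).
    by rewrite /q; field; rewrite !gt_eqF.
  by rewrite divr_gt0 ?subr_gt0// !mulr_gt0.
move=> t /andP[t0 t1]; have tau0 : 0 < 1 - t by rewrite subr_gt0.
have h := @Lpnorm_cube_ge R d p (2^-1 * (1 - t) `^ (- q)) (Num.sqrt ((1 - t) * del))
  (prof t) p0.
apply: le_trans (h _ _ _); rewrite ?sqrtr_ge0 ?mulr_ge0 ?powR_ge0//; last first.
  by move=> x hx; apply: core => //; rewrite t0.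
rewrite lee_fin -powR12_sqrt ?mulr_ge0 ?(ltW tau0) ?(ltW del0)// -powRrM.
have -> : 2^-1 * (d%:R / p) = d%:R / (2 * p) by field; rewrite gt_eqF.
rewrite powRM ?(ltW tau0) ?(ltW del0)//.
have -> : (1 - t) `^ (- (q - d%:R / (2 * p))) = (1 - t) `^ (- q) * (1 - t) `^ (d%:R / (2 * p)).
  by rewrite -powRD ?(gt_eqF tau0) ?implybT//; congr (_ `^ _); ring.
by rewrite le_eqVlt; apply/orP; left; apply/eqP; ring.
Qed.

Lemma selfsim_solution_blowupy :
  Lpnorm +oo (fun x : 'rV[R]_d => cabs (selfsim_solution (t, x))) @[t --> 1^'-] --> +oo%E.
Proof.
have [del del0 core] := exists_core.
apply: (@cvg_blowup _ 2^-1 q) => // t t01; have /andP[t0 t1] := t01.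
have tau0 : 0 < 1 - t by rewrite subr_gt0.
apply: (@Lpnormy_cube_ge R d _ (Num.sqrt ((1 - t) * del)) (prof t)).
  by rewrite sqrtr_gt0 mulr_gt0.
by move=> x hx; exact: core.
Qed.

End blowup.

Unset Implicit Arguments.
Set Strict Implicit.

Theorem theorem2 (R : realType) (d : nat) (sigma : R) (p : \bar R) :
  (1 <= d)%N -> 0 < sigma -> 1 < sigma * d%:R < 2 ->
  ((sigma * d%:R / (sigma * d%:R - 1))%:E < p)%E ->
  exists (Tc : R) (psi : R * 'rV[R]_d -> R * R),
    0 < Tc /\
    (* classical solution: smooth on (0,Tc) x R^d, continuous up to t = 0 *)
    smooth_on [set z | 0 < z.1 < Tc] psi /\
    {within [set z | 0 <= z.1 < Tc], continuous psi} /\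
    (forall z : R * 'rV[R]_d, 0 < z.1 < Tc ->
       mulI ('D_(e_time d) psi z) + laplacian psi z
       + (cabs (psi z) `^ (2 * sigma)) *: psi z = 0) /\
    (* singular in L^p at Tc *)
    (forall t, 0 <= t < Tc ->
       (Lpnorm p (fun x => cabs (psi (t, x))) < +oo)%E) /\
    (Lpnorm p (fun x => cabs (psi (t, x))) @[t --> Tc^'-] --> +oo%E).
Proof.
move=> d1 sg0 /andP[sd1 sd2] hp.
have [S1 [S2 [e [B [[e0 B0] CS [T1 [T2 [U1 [U2 prof]]]] [_ s0] decay]]]]] :=
  exists_selfsimilar_profile d1 sg0 sd1 sd2.
exists 1, (selfsim_solution sigma S1 S2); split; first exact: ltr01.
split; first exact: selfsim_solution_smooth e0 CS.
split; first exact: selfsim_solution_continuous e0 CS.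
split.
  by move=> z /andP[_ z1]; exact: (selfsim_solution_nls sg0 e0 CS prof).
have sdm : 0 < sigma * d%:R - 1 by rewrite subr_gt0.
case: p hp => [p|_|//].
  rewrite lte_fin => hp.
  have p0 : 0 < p by apply: lt_trans hp; rewrite divr_gt0//; lra.
  have hp1 : sigma * d%:R < p * (sigma * d%:R - 1) by rewrite -ltr_pdivrMr.
  have sdp : sigma * d%:R < p.
    by apply: lt_trans hp; rewrite ltr_pdivlMr//; nra.
  split; last exact: (selfsim_solution_blowup d1 sg0 e0 CS s0).
  move=> t t01; apply: (selfsim_solution_Lpnorm_fin d1 sg0 sd1 B0 decay p0 _ t01).
  have -> : (d%:R - sigma^-1) * p = p * (sigma * d%:R - 1) / sigma.
    by field; rewrite gt_eqF.
  by rewrite ltr_pdivlMr// mulrC.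
split; last exact: (selfsim_solution_blowupy d1 sg0 e0 CS s0).
by move=> t t01; exact: (selfsim_solution_Lpnormy_fin sg0 sd1 B0 decay t01).
Qed.
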